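(* Let $M$ be an odd-dimensional smooth manifold with a normal almost contact structure $(\varphi,F,\eta)$. If $\mathcal J$ represents the generalized almost contact structure on $M$ associated to $(\varphi,F,\eta)$, then it is a strong generalized contact structure.
   Context: Setting: on sections of $TM\oplus T^*M$ put $\langle X+\alpha,Y+\beta\rangle=\frac12(\iota_X\beta+\iota_Y\alpha)$ and the Courant bracket $[\![X+\alpha,Y+\beta]\!]=[X,Y]+\mathcal L_X\beta-\mathcal L_Y\alpha-\frac12 d(\iota_X\beta-\iota_Y\alpha)$, both extended complex-linearly to $(TM\oplus T^*M)_{\mathbb C}$. Convention: $d\eta(X,Y)=X\eta(Y)-Y\eta(X)-\eta([X,Y])$. An almost contact structure on $M$ is a triple $(\varphi,F,\eta)$ of a $(1,1)$-tensor $\varphi$, a vector field $F$ and a 1-form $\eta$ with $\varphi^2=-\mathbb I+\eta\otimes F$ and $\eta(F)=1$. It is normal if $\mathcal N_\varphi=-F\otimes d\eta$, $\mathcal L_F\varphi=0$ and $\mathcal L_F\eta=0$, where $\mathcal N_\varphi(X,Y)=[\varphi X,\varphi Y]+\varphi^2[X,Y]-\varphi([\varphi X,Y]+[X,\varphi Y])$. The associated generalized almost contact structure is $\mathcal J=(F,\eta,\pi=0,\theta=0,\varphi)$ with $\Phi=\begin{pmatrix}\varphi&0\\0&-\varphi^*\end{pmatrix}$ acting on $TM\oplus T^*M$, where $\varphi^*\alpha=\alpha\circ\varphi$. Bundles: $\ker\eta\subset TM$ and $\ker F=\{\alpha\in T^*M:\alpha(F)=0\}$; $L_F$ and $L_\eta$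 are the complex line bundles spanned by $F$ and $\eta$; $E^{(1,0)}=\{e-i\Phi(e): e\in\ker\eta\oplus\ker F\}$, $E^{(0,1)}=\{e+i\Phi(e): e\in\ker\eta\oplus\ker F\}$; $L=L_F\oplus E^{(1,0)}$, $L^*=L_\eta\oplus E^{(0,1)}$. The structure is a strong generalized contact structure if both $\Gamma(L)$ and $\Gamma(L^* )$ are closed under the Courant bracket. *)

(* Defs.v *)
From HB Require Import structures.
From mathcomp Require Import all_boot all_order all_algebra.
From mathcomp Require Import all_classical all_reals all_analysis.
From mathcomp Require Import ring.

Set Implicit Arguments.
Unset Strict Implicit.
Unset Printing Implicit Defensive.

Import Order.TTheory GRing.Theory Num.Theory.
Import numFieldNormedType.Exports.

Local Open Scope classical_set_scope.
Local Open Scope ring_scope.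

Section SmoothEuclidean.
Context {R : realType} {m : nat}.
Implicit Types (U : set 'rV[R]_m) (f g : 'rV[R]_m -> R).

(* [Ck k U f] is only meaningful for [U] open. *)
Fixpoint Ck (k : nat) U f : Prop :=
  (forall x, U x -> {for x, continuous f}) /\
  (if k is k'.+1 then
     forall i : 'I_m,
       (forall x, U x -> derivable f x (delta_mx 0 i)) /\
       Ck k' U (fun x => 'D_(delta_mx 0 i) f x)
   else True).

Definition smooth_on U f := forall k, Ck k U f.

End SmoothEuclidean.

Record chart (R : realType) (m : nat) (M : topologicalType) := Chart {
  chart_dom : set M;
  chart_map : M -> 'rV[R]_m;
  chart_inv : 'rV[R]_m -> M;
  chart_dom_open : open chart_dom;
  chart_img_open : open (chart_map @` chart_dom);
  chart_mapK : forall x, chart_dom x -> chart_inv (chart_map x) = x;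
  chart_map_continuous :
    forall x, chart_dom x -> {for x, continuous chart_map};
  chart_inv_continuous :
    forall y, (chart_map @` chart_dom) y -> {for y, continuous chart_inv}
}.

Arguments chart_dom_open {R m M} c : rename.
Arguments chart_img_open {R m M} c : rename.

Definition chart_compatible (R : realType) (m : nat) (M : topologicalType)
    (c c' : chart R m M) :=
  forall i : 'I_m,
    smooth_on (chart_map c @` (chart_dom c `&` chart_dom c'))
              (fun x => chart_map c' (chart_inv c x) 0 i).

Record smooth_manifold (R : realType) (m : nat) := SmoothManifold {
  manifold_carrier :> topologicalType;
  manifold_hausdorff : hausdorff_space manifold_carrier;
  manifold_second_countable : @second_countable manifold_carrier;
  atlas : set (chart R m manifold_carrier);
  atlas_cover : forall x, exists2 c, atlas c & chart_dom c x;
  atlas_compatible :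
    forall c c', atlas c -> atlas c' -> chart_compatible c c'
}.

Section CkTheory.
Context {R : realType} {m : nat}.
Implicit Types (U : set 'rV[R]_m) (f g : 'rV[R]_m -> R).

Lemma Ck_continuous k U f x : Ck k U f -> U x -> {for x, continuous f}.
Proof. by case: k => [|k] /= [fc _]; apply: fc. Qed.

Lemma CkW k U f : Ck k.+1 U f -> Ck k U f.
Proof.
elim: k f => [|k IH] f [fc fD]; split => // i.
by have [df /IH fk] := fD i.
Qed.

Lemma eq_Ck k U f g : open U -> (forall x, U x -> f x = g x) ->
  Ck k U f -> Ck k U g.
Proof.
move=> Uo; elim: k f g => [|k IH] f g fg [fc fD].
all: have nfg x : U x -> \near x, f x = g x.
1,3: by move=> Ux; apply: filterS (open_nbhs_nbhs (conj Uo Ux)) => y /fg.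
all: have gc x : U x -> {for x, continuous g}.
1,3: move=> Ux; rewrite /prop_for /continuous_at -(fg _ Ux).
1,2: by apply: cvg_trans (fc _ Ux); exact: near_eq_cvg (nfg _ Ux).
  by [].
split=> // i; have [df /IH fk] := fD i; split.
  by move=> x Ux; apply: near_eq_derivable (nfg _ Ux) (df _ Ux).
by apply: fk => x Ux; apply: near_eq_derive (nfg _ Ux).
Qed.

Lemma Ck_cst k U (c : R) : Ck k U (fun=> c).
Proof.
elim: k c => [|k IH] c; split => //; try by move=> x _; exact: cst_continuous.
move=> i; split; first by move=> x _; exact: derivable_cst.
suff -> : (fun x : 'rV[R]_m => 'D_(delta_mx 0 i) (fun=> c) x) = fun=> 0.
  exact: IH.
by apply/funext => x; exact: derive_cst.
Qed.

Lemma CkD k U f g : open U -> Ck k U f -> Ck k U g ->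
  Ck k U (fun x => f x + g x).
Proof.
move=> Uo; elim: k f g => [|k IH] f g [fc fD] [gc gD]; split => //.
- by move=> x Ux; apply: continuousD; [apply: fc|apply: gc].
- by move=> x Ux; apply: continuousD; [apply: fc|apply: gc].
move=> i; have [df fk] := fD i; have [dg gk] := gD i; split.
  by move=> x Ux; apply: derivableD; [apply: df|apply: dg].
apply: eq_Ck (IH _ _ fk gk) => // x Ux.
by rewrite deriveD //; [apply: df|apply: dg].
Qed.

Lemma CkM k U f g : open U -> Ck k U f -> Ck k U g ->
  Ck k U (fun x => f x * g x).
Proof.
move=> Uo; elim: k f g => [|k IH] f g Cf Cg;
  have fc x (Ux : U x) := Ck_continuous Cf Ux;
  have gc x (Ux : U x) := Ck_continuous Cg Ux; split => //.
- by move=> x Ux; apply: continuousM; [apply: fc|apply: gc].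
- by move=> x Ux; apply: continuousM; [apply: fc|apply: gc].
have [[_ fD] [_ gD]] := (Cf, Cg).
move=> i; have [df fk] := fD i; have [dg gk] := gD i; split.
  by move=> x Ux; apply: derivableM; [apply: df|apply: dg].
apply: eq_Ck (CkD Uo (IH _ _ (CkW Cf) gk) (IH _ _ (CkW Cg) fk)) => // x Ux.
by rewrite deriveM //; [apply: df|apply: dg].
Qed.

End CkTheory.

Section SmoothFunctions.
Context {R : realType} {m : nat} (M : smooth_manifold R m).

Definition smooth (f : M -> R) :=
  forall c, atlas c ->
    smooth_on (chart_map c @` chart_dom c) (f \o chart_inv c).

Definition smooth_pred : {pred (M -> R)} := fun f => `[< smooth f >].

Lemma smooth_subring : subring_closed smooth_pred.
Proof.
have N1 : forall f, smooth f -> smooth (- f).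
  move=> f sf c Ac k; have Uo := chart_img_open c.
  apply: eq_Ck (CkM Uo (Ck_cst k _ (-1)) (sf c Ac k)) => // x _ /=.
  by rewrite mulN1r.
split.
- by apply/asboolP => c Ac k; exact: Ck_cst.
- move=> f g /asboolP sf /asboolP/N1 sg; apply/asboolP => c Ac k.
  exact: CkD (chart_img_open c) (sf c Ac k) (sg c Ac k).
- move=> f g /asboolP sf /asboolP sg; apply/asboolP => c Ac k.
  exact: CkM (chart_img_open c) (sf c Ac k) (sg c Ac k).
Qed.

HB.instance Definition _ :=
  GRing.isSubringClosed.Build (M -> R) smooth_pred smooth_subring.

Record smooth_fun := SmoothFun {
  smooth_fun_val :> M -> R; _ : smooth_fun_val \in smooth_pred }.
HB.instance Definition _ := [isSub for smooth_fun_val].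
HB.instance Definition _ := [Choice of smooth_fun by <:].
HB.instance Definition _ := GRing.SubChoice_isSubComPzRing.Build
  (M -> R) smooth_pred smooth_fun smooth_subring.

Lemma smooth_cst (c : R) : cst c \in smooth_pred.
Proof. by apply/asboolP => ? _ k; exact: Ck_cst. Qed.
Definition cstC (c : R) : smooth_fun := SmoothFun (smooth_cst c).

End SmoothFunctions.

Notation "''Coo' ( M )" := (smooth_fun M) (format "''Coo' ( M )").

Section CalculusOnManifold.
Context {R : realType} {m : nat} (M : smooth_manifold R m).

(* A vector field is a derivation of the R-algebra of smooth functions; its
   value at p is the tangent vector f |-> (X f)(p), a derivation at p. *)
Definition is_derivation (X : 'Coo(M) -> 'Coo(M)) :=
  [/\ forall f g, X (f + g) = X f + X g,
      forall (a : R) f, X (cstC M a * f) = cstC M a * X f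
    & forall f g, X (f * g) = X f * g + f * X g].

Definition derivation_pred : {pred ('Coo(M) -> 'Coo(M)^o)} :=
  fun X => `[< is_derivation X >].

Lemma derivation_submod : subsemimod_closed derivation_pred.
Proof.
split; first split.
- apply/asboolP; split => [f g|a f|f g]; rewrite /= ?addr0 ?mulr0 ?mul0r //.
  by rewrite addr0.
- move=> X Y /asboolP[XD Xl XM] /asboolP[YD Yl YM]; apply/asboolP.
  split=> [f g|a f|f g].
  + by rewrite !fctE XD YD addrACA.
  + by rewrite !fctE Xl Yl mulrDr.
  + by rewrite !fctE XM YM mulrDl mulrDr addrACA.
- move=> h X /asboolP[XD Xl XM]; apply/asboolP; split=> [f g|a f|f g].
  + by rewrite !fctE XD scalerDr.
  + by rewrite !fctE Xl /GRing.scale/= mulrCA.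
  + by rewrite !fctE XM scalerDr /GRing.scale/= mulrA (mulrCA f).
Qed.

HB.instance Definition _ := GRing.isSubSemiModClosed.Build
  'Coo(M) ('Coo(M) -> 'Coo(M)^o) derivation_pred derivation_submod.

Record vector_field := VectorField {
  vector_field_val : 'Coo(M) -> 'Coo(M)^o;
  _ : vector_field_val \in derivation_pred }.
HB.instance Definition _ := [isSub for vector_field_val].
HB.instance Definition _ := [Choice of vector_field by <:].
HB.instance Definition _ := [SubChoice_isSubLmodule of vector_field by <:].

Definition vf_app (X : vector_field) : 'Coo(M) -> 'Coo(M) := vector_field_val X.
Coercion vf_app : vector_field >-> Funclass.

(* Tensor fields are C^oo(M)-multilinear maps on vector fields: a 1-form is
   C^oo(M)-linear with values in C^oo(M), a (1,1)-tensor is an element of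
   {linear vector_field -> vector_field}. *)
Definition is_form (al : vector_field -> 'Coo(M)) :=
  forall (h : 'Coo(M)) X Y, al (h *: X + Y) = h * al X + al Y.

Definition form_pred : {pred (vector_field -> 'Coo(M)^o)} :=
  fun al => `[< is_form al >].

Lemma form_submod : subsemimod_closed form_pred.
Proof.
split; first split.
- by apply/asboolP => h X Y; rewrite /= mulr0 addr0.
- move=> a b /asboolP aP /asboolP bP; apply/asboolP => h X Y.
  by rewrite !fctE aP bP mulrDr addrACA.
- move=> g a /asboolP aP; apply/asboolP => h X Y.
  by rewrite !fctE aP scalerDr /GRing.scale/= mulrCA.
Qed.

HB.instance Definition _ := GRing.isSubSemiModClosed.Build
  'Coo(M) (vector_field -> 'Coo(M)^o) form_pred form_submod.

Record one_form := OneForm {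
  form_val : vector_field -> 'Coo(M)^o;
  _ : form_val \in form_pred }.
HB.instance Definition _ := [isSub for form_val].
HB.instance Definition _ := [Choice of one_form by <:].
HB.instance Definition _ := [SubChoice_isSubLmodule of one_form by <:].

Definition form_app (al : one_form) : vector_field -> 'Coo(M) := form_val al.
Coercion form_app : one_form >-> Funclass.

Implicit Types (f g h : 'Coo(M)) (X Y Z : vector_field) (al be : one_form).

Lemma vfP X : is_derivation X.
Proof. by case: X => X /= /asboolP. Qed.

Lemma formP al : is_form al.
Proof. by case: al => al /= /asboolP. Qed.

Lemma vfD X f g : X (f + g) = X f + X g. Proof. by have [] := vfP X. Qed.
Lemma vfZ X (a : R) f : X (cstC M a * f) = cstC M a * X f.
Proof. by have [] := vfP X. Qed.
Lemma vfM X f g : X (f * g) = X f * g + f * X g.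
Proof. by have [] := vfP X. Qed.
Lemma vfB X f g : X (f - g) = X f - X g.
Proof. by apply: (addIr (X g)); rewrite -vfD !subrK. Qed.

Lemma addvfE X Y f : (X + Y) f = X f + Y f. Proof. by []. Qed.
Lemma scalevfE h X f : (h *: X) f = h * X f. Proof. by []. Qed.

Lemma vf_eq X Y : (forall f, X f = Y f) -> X = Y.
Proof. by move=> XY; apply: val_inj; apply/funext. Qed.
Lemma form_eq al be : (forall X, al X = be X) -> al = be.
Proof. by move=> ab; apply: val_inj; apply/funext. Qed.

Lemma lie_subproof X Y :
  ((fun f => X (Y f) - Y (X f)) : 'Coo(M) -> 'Coo(M)^o) \in derivation_pred.
Proof.
apply/asboolP; split=> [f g|a f|f g].
- by rewrite !vfD opprD addrACA.
- by rewrite !vfZ mulrBr.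
- rewrite !vfM !vfD !vfM mulrBl mulrBr; ring.
Qed.

Definition lie_bracket X Y : vector_field := VectorField (lie_subproof X Y).

Lemma lie_bracketE X Y f : lie_bracket X Y f = X (Y f) - Y (X f).
Proof. by []. Qed.

Lemma lie_bracketZr X h Y :
  lie_bracket X (h *: Y) = h *: lie_bracket X Y + X h *: Y.
Proof.
apply: vf_eq => f; rewrite addvfE !scalevfE !lie_bracketE !scalevfE vfM; ring.
Qed.

Lemma lie_bracketDr X Y Z :
  lie_bracket X (Y + Z) = lie_bracket X Y + lie_bracket X Z.
Proof.
by apply: vf_eq => f; rewrite addvfE !lie_bracketE !addvfE vfD opprD addrACA.
Qed.

Lemma formD al X Y : al (X + Y) = al X + al Y.
Proof. by rewrite -[X]scale1r formP mul1r scale1r. Qed.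
Lemma form0 al : al 0 = 0.
Proof. by apply: (addIr (al 0)); rewrite -formD !add0r. Qed.
Lemma formZ al h X : al (h *: X) = h * al X.
Proof. by rewrite -[h *: X]addr0 formP form0 addr0. Qed.

Lemma diff_subproof f :
  ((fun Z => Z f) : vector_field -> 'Coo(M)^o) \in form_pred.
Proof. by apply/asboolP. Qed.

Definition differential f : one_form := OneForm (diff_subproof f).

Lemma lie_form_subproof X be :
  ((fun Z => X (be Z) - be (lie_bracket X Z)) : vector_field -> 'Coo(M)^o)
    \in form_pred.
Proof.
apply/asboolP => h Y Z.
rewrite formP vfD vfM lie_bracketDr lie_bracketZr !formD !formZ; ring.
Qed.

Definition lie_form X be : one_form := OneForm (lie_form_subproof X be).

Lemma pullback_subproof (phi : {linear vector_field -> vector_field}) al :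
  (al \o phi : vector_field -> 'Coo(M)^o) \in form_pred.
Proof. by apply/asboolP => h X Y; rewrite /= linearP formP. Qed.

Definition transpose (phi : {linear vector_field -> vector_field}) al :
    one_form :=
  OneForm (pullback_subproof phi al).

Definition d_form al X Y : 'Coo(M) :=
  X (al Y) - Y (al X) - al (lie_bracket X Y).

Definition lie_endo X (phi : {linear vector_field -> vector_field}) Y :=
  lie_bracket X (phi Y) - phi (lie_bracket X Y).

Definition nijenhuis (phi : {linear vector_field -> vector_field}) X Y :=
  lie_bracket (phi X) (phi Y) + phi (phi (lie_bracket X Y))
  - phi (lie_bracket (phi X) Y + lie_bracket X (phi Y)).

(* Sections of TM (+) T*M. *)
Definition gsection : Type := (vector_field * one_form)%type.

Definition courant (s t : gsection) : gsection :=
  (lie_bracket s.1 t.1,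
   lie_form s.1 t.2 - lie_form t.1 s.2
   - cstC M (2^-1) *: differential (t.2 s.1 - s.2 t.1)).

(* Sections of the complexification: (u, v) stands for u + i v. *)
Definition csection : Type := (gsection * gsection)%type.

Definition to_csection (u : gsection) : csection := (u, 0).
Definition mul_i (s : csection) : csection := (- s.2, s.1).

Definition ccourant (s t : csection) : csection :=
  (courant s.1 t.1 - courant s.2 t.2, courant s.1 t.2 + courant s.2 t.1).

(* Values at the point p. A tangent vector is a derivation at p; a covector xi
   is recorded through X |-> xi (X_p). Every element of a fibre is the value of
   a global section, so the fibres below are described by global sections. *)
Definition value (p : M) (u : gsection) :
    ('Coo(M) -> R) * (vector_field -> R) :=
  (fun f => u.1 f p, fun X => u.2 X p).

Definition cvalue (p : M) (s : csection) := (value p s.1, value p s.2).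

End CalculusOnManifold.

Section GeneralizedContact.
Context {R : realType} {m : nat} {M : smooth_manifold R m}.
Implicit Types (F X Y : vector_field M) (eta : one_form M)
  (phi : {linear vector_field M -> vector_field M}) (s t : csection M) (p : M).

Definition almost_contact phi F eta :=
  (forall X, phi (phi X) = - X + eta X *: F) /\ eta F = 1.

Definition normal_almost_contact phi F eta :=
  [/\ almost_contact phi F eta,
      forall X Y, nijenhuis phi X Y = - (d_form eta X Y *: F),
      forall X, lie_endo F phi X = 0
    & lie_form F eta = 0].

(* The structure J = (F, eta, pi, theta, phi), in which (pi, theta, phi) enters
   through the endomorphism Phi of TM (+) T*M; no axiom is imposed on the raw
   data. For an almost contact structure pi = theta = 0. *)
Record generalized_contact_data := GeneralizedContactData {
  gc_F : vector_field M;
  gc_eta : one_form M;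
  gc_Phi : gsection M -> gsection M }.

Definition Phi_of phi (u : gsection M) : gsection M :=
  (phi u.1, - transpose phi u.2).

Definition associated_structure phi F eta : generalized_contact_data :=
  GeneralizedContactData F eta (Phi_of phi).

Implicit Types (J : generalized_contact_data).

(* The value of u at p lies in ker eta (+) ker F. *)
Definition in_kernels J p (u : gsection M) :=
  gc_eta J u.1 p = 0 /\ u.2 (gc_F J) p = 0.

(* The value of s at p lies in the complex line spanned by u. *)
Definition in_line (u : gsection M) p s :=
  exists a b : R, cvalue p s =
    cvalue p (cstC M a *: to_csection u + cstC M b *: mul_i (to_csection u)).

Definition in_E10 J p s :=
  exists2 e, in_kernels J p e &
    cvalue p s = cvalue p (to_csection e - mul_i (to_csection (gc_Phi J e))).

Definition in_E01 J p s :=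
  exists2 e, in_kernels J p e &
    cvalue p s = cvalue p (to_csection e + mul_i (to_csection (gc_Phi J e))).

Definition in_L J p s := exists s1 s2,
  [/\ in_line (gc_F J, 0) p s1, in_E10 J p s2 &
      cvalue p s = cvalue p (s1 + s2)].

Definition in_Lstar J p s := exists s1 s2,
  [/\ in_line (0, gc_eta J) p s1, in_E01 J p s2 &
      cvalue p s = cvalue p (s1 + s2)].

Definition courant_closed (B : M -> csection M -> Prop) :=
  forall s t, (forall p, B p s) -> (forall p, B p t) ->
    forall p, B p (ccourant s t).

Definition strong_generalized_contact J :=
  courant_closed (in_L J) /\ courant_closed (in_Lstar J).

End GeneralizedContact.

(* Main.v *)
Require Import Defs.
From mathcomp Require Import all_boot all_order all_algebra.
From mathcomp Require Import all_classical all_reals all_analysis.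
From mathcomp Require Import ring lra.

Set Implicit Arguments.
Unset Strict Implicit.
Unset Printing Implicit Defensive.

Import Order.TTheory GRing.Theory Num.Theory.
Import numFieldNormedType.Exports.

Local Open Scope classical_set_scope.
Local Open Scope ring_scope.

(** The proof has two parts of different nature.

    The algebraic part describes the sections of L and L-star globally. For
    a complex section (X + al) + i (Y + be), being in L at every point means
    Y = eta(Y) F - phi X, al(F) = 0 and be = al o phi ([sectionL]); being in
    L-star means eta(X) = 0, Y = phi X and be = be(F) eta - al o phi
    ([sectionLstar]). Both bundles are isotropic, so the exact term of the
    Courant bracket drops out and the bracket of two sections is made of Lie
    brackets and Lie derivatives only ([ccourant_re], [ccourant_im]).
    Normality enters through [lieF_phi] (phi commutes with L_F) and through
    the two identities obtained by applying eta and phi to the Nijenhuis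
    condition ([eta_lie_phi_phi], [phi_lie_phi_phi]); the latter says that
      phi [X, Y] - [X, phi Y] - [phi X, Y] - phi [phi X, phi Y]
    is a multiple of F. With these, closedness is a computation
    ([ccourant_sectionL], [ccourant_sectionLstar]).

    The analytic part is needed to pass from membership in the fibres to the
    global description. Vector fields are derivations and tensors are
    function-linear maps, so one has to know that eta(X) and phi X at p
    depend only on X at p ([form_pointwise], [endo_pointwise]). Given a
    chart at p and a bump function chi supported in it, let b, x_i and d_i
    be the global functions chi, chi x_i and the global vector fields
    chi d/dx_i. Then every vector field Z satisfies
      b^3 Z = sum_i (b Z(x_i) - x_i Z(b)) d_i
    ([cutoff_decomposition]), whose coefficients vanish at p if Z does,
    while b(p) <> 0. This identity follows from Hadamard's lemma
    ([hadamard]) with smooth quotients, which are obtained by integrating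
    partial derivatives along segments parallel to the axes. The smoothness
    of the quotients comes from differentiation under the integral sign,
    that of functions extended by zero from the chain rule
    ([smooth_on_comp]) and the Hausdorff property. *)

(** * Flat functions on the line *)

Section FlatFunctions.
Context {R : realType}.
Implicit Types (x : R) (n : nat).

(** The functions x^-n exp(-1/x) for x > 0, extended by 0. Their derivatives
    are combinations of functions of the same family. *)
Definition flat n x : R := if 0 < x then x^-1 ^+ n * expR (- x^-1) else 0.

Lemma flat_ge0 n x : 0 <= flat n x.
Proof.
rewrite /flat; case: ifPn => // x0.
by rewrite mulr_ge0 ?expR_ge0 // exprn_ge0 // invr_ge0 ltW.
Qed.

Lemma flat_gt0 n x : 0 < x -> 0 < flat n x.
Proof.
by move=> x0; rewrite /flat x0 mulr_gt0 ?expR_gt0 ?exprn_gt0 ?invr_gt0.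
Qed.

Lemma flat_le0 n x : x <= 0 -> flat n x = 0.
Proof. by rewrite /flat ltNge => ->. Qed.

Lemma flat_le_linear n x : 0 < x -> flat n x <= (n.+1)`!%:R * x.
Proof.
move=> x0; rewrite /flat x0; set u := x^-1.
have u0 : 0 < u by rewrite invr_gt0.
have fn0 : (0 : R) < (n.+1)`!%:R by rewrite ltr0n fact_gt0.
have le_exp : u ^+ n.+1 <= (n.+1)`!%:R * expR u.
  rewrite mulrC -ler_pdivrMr //.
  by apply: le_trans (expR_ge1Dxn n (ltW u0)); rewrite lerDr.
rewrite expRN ler_pdivrMr ?expR_gt0 // -(ler_pM2l u0) -exprS.
rewrite [leRHS](_ : _ = (n.+1)`!%:R * expR u) //.
by rewrite /u; field; rewrite gt_eqF.
Qed.

Lemma is_derive_flat n x :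
  is_derive x 1 (flat n) (flat n.+2 x - n%:R * flat n.+1 x).
Proof.
have [x0|x0|->] := ltgtP x 0.
- rewrite !flat_le0 ?ltW // mulr0 subr0.
  have near0 : \near x, cst (0 : R) x = flat n x.
    near=> y; rewrite flat_le0 //; apply/ltW; near: y; exact: lt_nbhsl.
  exact: near_eq_is_derive near0 _.
- have nearE : \near x, ((fun y : R => y^-1 ^+ n) * (fun y => expR (- y^-1))) x
      = flat n x.
    near=> y; rewrite /flat ifT //; near: y; exact: lt_nbhsr.
  apply: (near_eq_is_derive nearE).
  have xn0 : x != 0 by rewrite gt_eqF.
  have dV : is_derive x 1 (fun y : R => y^-1) (- x^-2).
    by have := is_deriveV xn0 (is_derive_id x 1); rewrite /GRing.scale /= mulr1.
  have dX := is_deriveX n dV.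
  have dE : is_derive x 1 (fun y : R => expR (- y^-1))
      (expR (- x^-1) * - - x^-2).
    apply: (@is_derive1_comp _ expR (fun y => - y^-1)).
  have XE : GRing.inv ^+ n = (fun y : R => y^-1 ^+ n) by rewrite exprfctE.
  rewrite -{}XE; apply: is_derive_eq (is_deriveM dX dE) _.
  rewrite /flat x0 exprfctE /GRing.scale /=.
  by case: n {nearE dX} => [|n]; rewrite ?exprS; field.
rewrite !flat_le0 // mulr0 subr0.
suff H : h^-1 *: ((flat n \o shift 0) (h *: (1 : R)) - flat n 0)
    @[h --> 0^'] --> (0 : R).
  by apply: DeriveDef; [apply: cvgP H | apply: cvg_lim H].
(* For h > 0 the quotient flat n h / h is flat n.+1 h, which is O(h). *)
apply: (@cvg_to_0_linear _ _ (n.+2)`!%:R 1) => // h /andP[h0 _].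
rewrite /= addr0 [flat n 0]flat_le0 // subr0 /GRing.scale /= mulr1.
have [hlt|hgt] := leP h 0.
  by rewrite flat_le0 // mulr0 normr0 mulr_ge0.
have -> : h^-1 * flat n h = flat n.+1 h by rewrite /flat hgt exprS mulrA.
by rewrite ger0_norm ?flat_ge0 // gtr0_norm // flat_le_linear.
Unshelve. all: by end_near. Qed.

Lemma continuous_flat n : continuous (flat n).
Proof.
move=> x; apply: differentiable_continuous; apply/derivable1_diffP.
by have [] := is_derive_flat n x.
Qed.

End FlatFunctions.

(** * Functions of class C^k on open subsets of R^m *)

Section LineDerivative.
Context {R : realType} {V : normedModType R}.
Implicit Types (f : V -> R) (x v : V).

(** A derivative along v is the derivative of the restriction to a line. *)
Lemma derive_line f x v (h d : R) :
  is_derive h 1 (fun s : R => f (s *: v + x)) d <-> is_derive (h *: v + x) v f d.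
Proof.
have E : (fun s : R => s^-1 *:
      (((fun s => f (s *: v + x)) \o shift h) (s *: (1 : R)) - f (h *: v + x))) =
    (fun s : R => s^-1 *:
      ((f \o shift (h *: v + x)) (s *: v) - f (h *: v + x))).
  apply/funext => s /=; congr (_ *: (f _ - _)).
  by rewrite scalerDl addrA [s *: 1]mulr1.
have D : 'D_1 (fun s : R => f (s *: v + x)) h = 'D_v f (h *: v + x).
  by rewrite /derive E.
have E' : derivable (fun s : R => f (s *: v + x)) h 1 = derivable f (h *: v + x) v.
  by rewrite /derivable E.
split=> -[df dE]; split.
- by rewrite -E'.
- by rewrite -D.
- by rewrite E'.
- by rewrite D.
Qed.

Lemma derive_line0 f x v (d : R) :
  is_derive (0 : R) 1 (fun s : R => f (s *: v + x)) d <-> is_derive x v f d.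
Proof. by rewrite derive_line scale0r add0r. Qed.

End LineDerivative.

Section CkMore.
Context {R : realType} {m : nat}.
Implicit Types (U V : set 'rV[R]_m) (f g : 'rV[R]_m -> R).

Lemma CkS k U V f : V `<=` U -> Ck k U f -> Ck k V f.
Proof.
move=> VU; elim: k f => [|k IH] f [fc fD]; split => //.
- by move=> x /VU; exact: fc.
- by move=> x /VU; exact: fc.
- move=> i; have [df /IH fk] := fD i; split=> // x /VU; exact: df.
Qed.

Lemma CkU k U V f : Ck k U f -> Ck k V f -> Ck k (U `|` V) f.
Proof.
elim: k f => [|k IH] f [fU DU] [fV DV]; split => //.
- by move=> x []; [exact: fU | exact: fV].
- by move=> x []; [exact: fU | exact: fV].
- move=> i; have [dU kU] := DU i; have [dV kV] := DV i; split; last exact: IH.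
  by move=> x []; [exact: dU | exact: dV].
Qed.

Lemma smooth_onD U f g : open U -> smooth_on U f -> smooth_on U g ->
  smooth_on U (fun x => f x + g x).
Proof. by move=> Uo fU gU k; exact: CkD. Qed.

Lemma smooth_onM U f g : open U -> smooth_on U f -> smooth_on U g ->
  smooth_on U (fun x => f x * g x).
Proof. by move=> Uo fU gU k; exact: CkM. Qed.

Lemma smooth_on_sum (I : Type) (r : seq I) U (F : I -> 'rV[R]_m -> R) :
  open U -> (forall i, smooth_on U (F i)) ->
  smooth_on U (fun x => \sum_(i <- r) F i x).
Proof.
move=> Uo FU; elim: r => [|i r IH] k.
  by apply: eq_Ck (Ck_cst k U 0) => // x _; rewrite big_nil.
apply: eq_Ck (CkD Uo (FU i k) (IH k)) => // x _.
by rewrite big_cons.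
Qed.

Lemma smooth_on_derivable U f i x :
  smooth_on U f -> U x -> derivable f x (delta_mx 0 i).
Proof. by move=> /(_ 1)[_ /(_ i) [df _]]; exact: df. Qed.

Lemma smooth_on_derive U f i :
  smooth_on U f -> smooth_on U (fun x => 'D_(delta_mx 0 i) f x).
Proof. by move=> fU k; have [_ /(_ i) [_]] := fU k.+1. Qed.

Lemma smooth_on_continuous U f x : smooth_on U f -> U x -> {for x, continuous f}.
Proof. by move=> fU; exact: (Ck_continuous (fU 0)). Qed.

Lemma is_derive_coord (g : R -> R) (i j : 'I_m) (x : 'rV[R]_m) d :
  is_derive (x 0 i) 1 g d ->
  is_derive x (delta_mx 0 j) (fun y : 'rV[R]_m => g (y 0 i)) (d * (i == j)%:R).
Proof.
move=> dg; apply/derive_line0.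
have -> : (fun s : R => g ((s *: delta_mx 0 j + x) 0 i)) =
    (fun s : R => g (s * (i == j)%:R + x 0 i)).
  by apply/funext => s; rewrite !mxE eqxx.
have dl : is_derive (0 : R) 1 (fun s : R => s * (i == j)%:R + x 0 i) (i == j)%:R.
  have dM := is_deriveM (is_derive_id (0 : R) 1)
    (is_derive_cst ((i == j)%:R : R) (0 : R) 1).
  apply: is_derive_eq (is_deriveD dM (is_derive_cst (x 0 i) (0 : R) 1)) _.
  by rewrite scaler0 add0r addr0 [_ *: 1]mulr1.
apply: (@is_derive1_comp _ g (fun s : R => s * (i == j)%:R + x 0 i)).
by rewrite mul0r add0r.
Qed.

Lemma smooth_coord (i : 'I_m) : smooth_on setT (fun x : 'rV[R]_m => x 0 i).
Proof.
case=> [|k]; split => //; try by move=> x _; exact: coord_continuous.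
move=> j; have d x := @is_derive_coord id i j x 1 (is_derive_id _ _).
split=> [x _|]; first by have [] := d x.
apply: eq_Ck (Ck_cst k _ (i == j)%:R); first exact: openT.
by move=> x _; have [_ ->] := d x; rewrite mul1r.
Qed.

Lemma smooth_flat n (i : 'I_m) :
  smooth_on setT (fun x : 'rV[R]_m => flat n (x 0 i)).
Proof.
move=> k; elim: k n => [|k IH] n; split => //.
- move=> x _; apply: (@continuous_comp _ _ _ (fun y : 'rV[R]_m => y 0 i) (flat n)).
    exact: coord_continuous.
  exact: continuous_flat.
- move=> x _; apply: (@continuous_comp _ _ _ (fun y : 'rV[R]_m => y 0 i) (flat n)).
    exact: coord_continuous.
  exact: continuous_flat.
move=> j; have d (x : 'rV[R]_m) := is_derive_coord j (is_derive_flat n (x 0 i)).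
split=> [x _|]; first by have [] := d x.
have T := @openT 'rV[R]_m.
apply: eq_Ck (CkM T (CkD T (IH n.+2) (CkM T (Ck_cst k _ (- n%:R)) (IH n.+1)))
  (Ck_cst k _ (i == j)%:R)) => // x _.
by have [_ ->] := d x; rewrite mulNr.
Qed.

End CkMore.

(** * Integrals over [0, 1] depending on a parameter *)

Section ParametricIntegral.
Context {R : realType} {V : normedModType R}.
Implicit Types (P Q : R -> V -> R) (x v : V).
Local Notation mu := (@lebesgue_measure R).

(** The integral of P t x over t in [0, 1], as a function of x. *)
Definition integral01 P x : R := \int[mu]_(t in `[0, 1]) P t x.

Definition jointly_continuous P := continuous (fun z : R * V => P z.1 z.2).

Lemma jointly_continuous_left P x : jointly_continuous P -> continuous (P ^~ x).
Proof.
move=> Pc t; apply: (@continuous2_cvg _ R V R (nbhs t) _ id (fun=> x) P t x).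
- exact: (Pc (t, x)).
- exact: cvg_id.
- exact: cvg_cst.
Qed.

Lemma integrable01 P x : jointly_continuous P ->
  mu.-integrable `[0, 1] (EFin \o P ^~ x).
Proof.
move=> Pc; apply: continuous_compact_integrable; first exact: segment_compact.
apply: continuous_subspaceT; exact: jointly_continuous_left.
Qed.

(** By compactness of [0, 1], continuity in the parameter is uniform in t. *)
Lemma near_uniform P x e : jointly_continuous P -> 0 < e ->
  \forall y \near x, forall t, `[0, 1]%classic t -> `|P t x - P t y| <= e.
Proof.
move=> Pc e0.
have /compact_near_coveringP cov := @segment_compact R 0 1.
apply: (cov _ (nbhs x) (fun y t => `|P t x - P t y| <= e)) => t _.
have e20 : 0 < e / 2 by rewrite divr_gt0.
have near1 : \forall s \near t, `|P t x - P s x| < e / 2.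
  by have /cvgrPdist_lt := @jointly_continuous_left _ x Pc t; apply.
have near2 : \forall z \near (t, x), `|P t x - P z.1 z.2| < e / 2.
  by have /cvgrPdist_lt := Pc (t, x); apply.
have [[A B] /= [At Bx] AB] := near2.
exists (A `&` [set s | `|P t x - P s x| < e / 2], B) => /=.
  by split => //; apply: filterI.
move=> [s y] [/= [As Ps] By].
have /= Psy := AB (s, y) (conj As By).
have -> : P s x - P s y = (P t x - P s y) - (P t x - P s x) by ring.
by apply: le_trans (ler_normB _ _) _; rewrite [e]splitr ltW // ltrD.
Qed.

Lemma continuous_integral01 P : jointly_continuous P -> continuous (integral01 P).
Proof.
move=> Pc x; apply/cvgrPdist_le => e e0.
near=> y.
have Py : forall t, `[0, 1]%classic t -> `|P t x - P t y| <= e.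
  by near: y; exact: near_uniform.
have iP z := @integrable01 P z Pc.
rewrite /integral01 -RintegralB //; [|exact: measurable_itv..].
have iD : mu.-integrable `[0, 1] (EFin \o (fun t => P t x - P t y)).
  apply: eq_integrable (integrableB _ (iP x) (iP y)) => //.
apply: le_trans (le_normr_Rintegral _ iD) _ => //.
apply: (@le_trans _ _ (\int[mu]_(t in `[0, 1]) e)).
  apply: le_Rintegral => //.
  - exact: (@integrable_norm _ _ _ mu `[0,1]%classic (fun t => P t x - P t y)).
  - apply: continuous_compact_integrable; first exact: segment_compact.
    by apply: continuous_subspaceT => ?; exact: cvg_cst.
rewrite Rintegral_cst //= lebesgue_measure_itv /= lte_fin ltr01 -EFinD /= subr0.
by rewrite mulr1.
Unshelve. all: by end_near. Qed.

Lemma is_derive_integral01 P Q x v :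
  jointly_continuous P -> jointly_continuous Q ->
  (forall t y, is_derive y v (P t) (Q t y)) ->
  is_derive x v (integral01 P) (integral01 Q x).
Proof.
move=> Pc Qc dP; apply/derive_line0.
have dl (t s : R) : is_derive s 1 (fun h : R => P t (h *: v + x)) (Q t (s *: v + x)).
  by apply/derive_line.
have p1E (s t : R) :
    partial1of2 (fun s t : R => P t (s *: v + x)) s t = Q t (s *: v + x).
  by rewrite partial1of2E; have [_ ->] := dl t s.
have [C [C0 QC]] : exists C : R,
    0 <= C /\ forall t, `[0, 1]%classic t -> `|Q t x| <= C.
  have : compact ((Q ^~ x) @` `[0, 1]%classic).
    apply: continuous_compact; last exact: segment_compact.
    by apply: continuous_subspaceT; exact: jointly_continuous_left.
  move=> /compact_bounded[M [_ HM]]; exists (`|M| + 1); split.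
    by rewrite addr_ge0.
  move=> t t01; apply: HM; last by exists t.
  by rewrite ltr_pwDr // ler_norm.
have lc : (fun s : R => s *: v + x) @ (0 : R) --> x.
  have lv : (fun s : R => s *: v) @ (0 : R) --> 0 *: v by exact: scalel_continuous.
  have := @cvgD _ _ _ _ _ _ (fun=> x) _ x lv (cvg_cst x); rewrite scale0r add0r.
  exact.
have [d /= d0 Hd] : \forall s \near (0 : R), forall t, `[0, 1]%classic t ->
    `|Q t (s *: v + x)| <= C + 1.
  apply: (@filterS _ (nbhs (0 : R)) _ _ _ _ (lc _ (near_uniform x Qc ltr01))).
  move=> s /= Hs t t01.
  have -> : Q t (s *: v + x) = Q t x - (Q t x - Q t (s *: v + x)) by ring.
  by apply: le_trans (ler_normB _ _) _; apply: lerD; [exact: QC|exact: Hs].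
have I0 : `]- d, d[%classic (0 : R) by rewrite /= in_itv /= oppr_lt0 d0.
have intP (s : R) : `]- d, d[%classic s ->
    mu.-integrable `[0, 1] (EFin \o (fun t => P t (s *: v + x))).
  by move=> _; exact: integrable01.
have derP (s t : R) : `]- d, d[%classic s -> `[0, 1]%classic t ->
    derivable (fun s : R => P t (s *: v + x)) s 1.
  by move=> _ _; have [] := dl t s.
have intC : mu.-integrable `[0, 1] (EFin \o (fun=> C + 1)).
  apply: continuous_compact_integrable; first exact: segment_compact.
  by apply: continuous_subspaceT => ?; exact: cvg_cst.
have ubC (s t : R) : `]- d, d[%classic s -> `[0, 1]%classic t ->
    `|partial1of2 (fun s t : R => P t (s *: v + x)) s t| <= C + 1.
  move=> sd t01; rewrite p1E; apply: Hd => //=.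
  by rewrite sub0r normrN ltr_norml; move: sd; rewrite /= in_itv.
have mB : measurable (`[0, 1]%classic : set (measurableTypeR R)) by exact: measurable_itv.
have G0 (t : R) : 0 <= C + 1 by rewrite addr_ge0.
apply: DeriveDef; first exact: (derivable_under_integral mB I0 intP derP G0 intC ubC).
rewrite -derive1E (differentiation_under_integral mB I0 intP derP G0 intC ubC).
by apply: eq_Rintegral => t _; rewrite p1E scale0r add0r.
Qed.

End ParametricIntegral.

(** * Hadamard's lemma *)

Section Hadamard.
Context {R : realType} {m : nat}.
Implicit Types (f : 'rV[R]_m -> R) (x q : 'rV[R]_m) (i j : 'I_m) (t : R).

(** The affine map contracting the i-th coordinate towards that of q with
    ratio t and fixing the other coordinates; it is the identity for t = 1,
    and for t = 0 it sets the i-th coordinate to that of q. *)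
Definition shrink q i t x : 'rV[R]_m :=
  x + ((t - 1) * (x 0 i - q 0 i)) *: delta_mx 0 i.

Lemma shrinkE q i t x j :
  shrink q i t x 0 j = if i == j then q 0 i + t * (x 0 i - q 0 i) else x 0 j.
Proof.
rewrite !mxE eqxx eq_sym /=; case: eqP => [->|_]; last by rewrite mulr0 addr0.
by rewrite mulr1; ring.
Qed.

Lemma shrink1 q i x : shrink q i 1 x = x.
Proof. by rewrite /shrink subrr mul0r scale0r addr0. Qed.

Lemma shrinkq q i t : shrink q i t q = q.
Proof. by rewrite /shrink subrr mulr0 scale0r addr0. Qed.

Lemma shrink_line q i t x j (s : R) :
  shrink q i t (s *: delta_mx 0 j + x) =
  (s * (if i == j then t else 1)) *: delta_mx 0 j + shrink q i t x.
Proof.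
apply/rowP => k; rewrite !(shrinkE, mxE) eqxx /=.
case: (eqVneq i j) => [->|ij].
  by case: (eqVneq j k) => [->|jk]; rewrite ?eqxx /=; ring.
case: (eqVneq i k) ij => [->|ik] kj; rewrite ?mxE ?eqxx ?(negPf kj) /=; ring.
Qed.

Lemma shrink_time q i t x :
  shrink q i t x = (t * (x 0 i - q 0 i)) *: delta_mx 0 i + shrink q i 0 x.
Proof.
apply/rowP => k; rewrite !(shrinkE, mxE) eqxx /= eq_sym.
by case: (eqVneq i k) => [->|ik]; rewrite ?eqxx /=; ring.
Qed.

Lemma continuous_shrink q i :
  continuous (fun z : R * 'rV[R]_m => shrink q i z.1 z.2).
Proof.
move=> [t x]; apply: cvgD; first exact: cvg_snd.
apply: cvgZr_tmp; apply: cvgM; apply: cvgB.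
- exact: cvg_fst.
- exact: cvg_cst.
- apply: (@continuous_comp _ _ _ snd (fun y : 'rV[R]_m => y 0 i)).
    exact: cvg_snd.
  exact: coord_continuous.
- exact: cvg_cst.
Qed.

Lemma continuous_shrink_space q i t : continuous (shrink q i t).
Proof.
move=> x; apply: (@continuous2_cvg _ R 'rV[R]_m 'rV[R]_m (nbhs x) _ (fun=> t) id
  (shrink q i) t x).
- have := @continuous_shrink q i (t, x); rewrite /continuous_at /=. exact.
- exact: cvg_cst.
- exact: cvg_id.
Qed.

(** The exponent of t is 1 if i = j and 0 otherwise. *)
Lemma is_derive_shrink q i t f j x :
  derivable f (shrink q i t x) (delta_mx 0 j) ->
  is_derive x (delta_mx 0 j) (f \o shrink q i t)
    (t ^+ (i == j) * 'D_(delta_mx 0 j) f (shrink q i t x)).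
Proof.
move=> /derivableP df; apply/derive_line0.
set c := if i == j then t else 1.
have -> : (fun s : R => (f \o shrink q i t) (s *: delta_mx 0 j + x)) =
    (fun s : R => f ((s * c) *: delta_mx 0 j + shrink q i t x)).
  by apply/funext => s /=; rewrite shrink_line.
have dM : is_derive (0 : R) 1 (fun s : R => s * c) c.
  apply: is_derive_eq
    (is_deriveM (is_derive_id (0 : R) 1) (is_derive_cst c (0 : R) 1)) _.
  by rewrite scaler0 add0r [_ *: 1]mulr1.
have E : t ^+ (i == j) = c by rewrite /c; case: eqP; rewrite ?expr1 ?expr0.
rewrite E mulrC.
apply: (@is_derive1_comp _ (fun s : R => f (s *: delta_mx 0 j + shrink q i t x))
  (fun s => s * c)).
by apply/derive_line; rewrite mul0r scale0r add0r.
Qed.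

Lemma smooth_shrink q i t f :
  smooth_on setT f -> smooth_on setT (f \o shrink q i t).
Proof.
move=> fs k; elim: k f fs => [|k IH] f fs.
all: have fc x : setT x -> {for x, continuous (f \o shrink q i t)}.
1,3: move=> _; apply: continuous_comp; last exact: smooth_on_continuous fs _.
1,2: exact: continuous_shrink_space.
  by split.
split=> // j; have d x := is_derive_shrink
  (smooth_on_derivable (i := j) (x := shrink q i t x) fs I).
split=> [x _|]; first by have [] := d x.
have T := @openT 'rV[R]_m.
apply: eq_Ck (CkM T (Ck_cst k _ (t ^+ (i == j))) (IH _ (smooth_on_derive j fs))) => //.
by move=> x _; have [_ ->] := d x.
Qed.

(** The integral over t in [0, 1] of t^l f(shrink q i t x). The weight t^l
    makes this family stable under partial derivatives, so that its
    smoothness is an induction on the order of differentiability. *)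
Definition average q i l f : 'rV[R]_m -> R :=
  integral01 (fun t x => t ^+ l * f (shrink q i t x)).

Lemma jointly_continuous_average q i l f : smooth_on setT f ->
  jointly_continuous (fun t x => t ^+ l * f (shrink q i t x)).
Proof.
move=> fs z.
have c1 : {for z, continuous (fun z : R * 'rV[R]_m => z.1 ^+ l)}.
  apply: (@continuous_comp _ _ _ fst (fun t : R => t ^+ l)).
    exact: cvg_fst.
  exact: exprn_continuous.
have c2 : {for z, continuous (fun z : R * 'rV[R]_m => f (shrink q i z.1 z.2))}.
  apply: (@continuous_comp _ _ _ (fun z : R * 'rV[R]_m => shrink q i z.1 z.2) f).
    exact: continuous_shrink.
  exact: smooth_on_continuous fs _.
exact: continuousM c1 c2.
Qed.

Lemma is_derive_average q i l f j x : smooth_on setT f ->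
  is_derive x (delta_mx 0 j) (average q i l f)
    (average q i (l + (i == j)) (fun y => 'D_(delta_mx 0 j) f y) x).
Proof.
move=> fs; apply: is_derive_integral01.
- exact: jointly_continuous_average.
- exact: (@jointly_continuous_average q i (l + (i == j)) _ (smooth_on_derive j fs)).
move=> t y; have d := is_derive_shrink
  (smooth_on_derivable (i := j) (x := shrink q i t y) fs I).
apply: is_derive_eq (is_deriveM (is_derive_cst (t ^+ l) y (delta_mx 0 j)) d) _.
by rewrite scaler0 addr0 /GRing.scale /= mulrA exprD.
Qed.

Lemma smooth_average q i l f : smooth_on setT f -> smooth_on setT (average q i l f).
Proof.
move=> fs k; elim: k l f fs => [|k IH] l f fs.
all: have fc x : setT x -> {for x, continuous (average q i l f)}.
1,3: move=> _; apply: continuous_integral01; exact: jointly_continuous_average.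
  by split.
split=> // j; split=> [x _|]; first by have [] := is_derive_average q i l j x fs.
apply: eq_Ck (IH _ _ (smooth_on_derive j fs)); first exact: openT.
by move=> x _; have [_ ->] := is_derive_average q i l j x fs.
Qed.

Lemma averageq q i f : average q i 0 f q = f q.
Proof.
rewrite /average /integral01; under eq_Rintegral do rewrite shrinkq expr0 mul1r.
rewrite Rintegral_cst //= lebesgue_measure_itv /= lte_fin ltr01 -EFinD /= subr0.
by rewrite mulr1.
Qed.

(** The fundamental theorem of calculus along a segment in direction i. *)
Lemma shrink_diff q i f x : smooth_on setT f ->
  f x - f (shrink q i 0 x) =
  (x 0 i - q 0 i) * average q i 0 (fun y => 'D_(delta_mx 0 i) f y) x.
Proof.
move=> fs; set d := x 0 i - q 0 i; set f' := fun y => 'D_(delta_mx 0 i) f y.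
have f's : smooth_on setT f' by exact: smooth_on_derive.
have dF t : is_derive t 1 (fun t : R => f (shrink q i t x)) (d * f' (shrink q i t x)).
  have -> : (fun t : R => f (shrink q i t x)) =
      (fun t : R => f ((t * d) *: delta_mx 0 i + shrink q i 0 x)).
    by apply/funext => s; rewrite shrink_time.
  have dM : is_derive (t : R) 1 (fun s : R => s * d) d.
    apply: is_derive_eq (is_deriveM (is_derive_id t 1) (is_derive_cst d t 1)) _.
    by rewrite scaler0 add0r [_ *: 1]mulr1.
  rewrite mulrC; apply: (@is_derive1_comp _
    (fun s : R => f (s *: delta_mx 0 i + shrink q i 0 x)) (fun s => s * d)).
  apply/derive_line; rewrite -shrink_time; apply: derivableP.
  exact: smooth_on_derivable fs _.
have cF' : continuous (fun t : R => 1 * f' (shrink q i t x)).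
  have := @jointly_continuous_left _ _ _ x (@jointly_continuous_average q i 0 _ f's).
  by under eq_fun do rewrite expr0.
have cdF' : continuous (fun t : R => d * f' (shrink q i t x)).
  move=> t; apply: cvgM; first exact: cvg_cst.
  have := cF' t; rewrite /continuous_at mul1r.
  by under eq_fun do rewrite mul1r.
have cF : continuous (fun t : R => f (shrink q i t x)).
  move=> t; apply: differentiable_continuous; apply/derivable1_diffP.
  by have [] := dF t.
have := @continuous_FTC2 R (fun t => d * f' (shrink q i t x))
  (fun t => f (shrink q i t x)) 0 1 ltr01 _ _ _.
rewrite shrink1 -EFinB => FTC.
rewrite /average /integral01 -RintegralZl //; last first.
  apply: (integrable01 x (@jointly_continuous_average q i 0 _ f's)).
under eq_Rintegral do rewrite expr0 mul1r.
rewrite /Rintegral FTC //.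
- exact: continuous_subspaceT.
- split.
  + by move=> t _; have [] := dF t.
  + apply: cvg_at_right_filter; exact: cF.
  + apply: cvg_at_left_filter.
    rewrite -[X in _ --> X]/((fun t => f (shrink q i t x)) 1); exact: cF.
- by move=> t _; rewrite derive1E; have [_ ->] := dF t.
Qed.

(** The point x with the coordinates listed in s replaced by those of q. *)
Definition freeze q (s : seq 'I_m) x : 'rV[R]_m :=
  \row_j (if j \in s then q 0 j else x 0 j).

(** Hadamard's lemma for the coordinates in s, by replacing one coordinate
    at a time. *)
Lemma hadamard_freeze q (s : seq 'I_m) f : uniq s -> smooth_on setT f ->
  exists G : 'I_m -> 'rV[R]_m -> R,
    [/\ forall i, smooth_on setT (G i),
        forall x, f x - f (freeze q s x) = \sum_(i <- s) (x 0 i - q 0 i) * G i x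
      & forall i, i \in s -> G i q = 'D_(delta_mx 0 i) f q].
Proof.
elim: s f => [|i s IH] f /=.
  move=> _ fs; exists (fun=> f); split => // x; rewrite big_nil.
  suff -> : freeze q [::] x = x by rewrite subrr.
  by apply/rowP => j; rewrite mxE.
move=> /andP[iNs us] fs.
have [G [Gs GE Gq]] := IH _ us (smooth_shrink q i 0 fs).
exists (fun j => if j == i then average q i 0 (fun y => 'D_(delta_mx 0 i) f y)
                 else G j); split.
- move=> j; case: ifP => _ //; apply: smooth_average; exact: smooth_on_derive.
- move=> x; rewrite big_cons eqxx -shrink_diff //.
  rewrite [X in _ = _ + X](_ : _ = \sum_(j <- s) (x 0 j - q 0 j) * G j x).
    rewrite -GE /= (_ : freeze q (i :: s) x = shrink q i 0 (freeze q s x)).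
      by rewrite addrA subrK.
    apply/rowP => j; rewrite shrinkE !mxE inE.
    by rewrite [j == i]eq_sym; case: eqP => [->|//]; rewrite /= mul0r addr0.
  apply: eq_big_seq => j js; case: eqP => // ji.
  by move: iNs; rewrite -ji js.
move=> j; rewrite inE; case: eqP => /= [-> _|/eqP ji js]; first exact: averageq.
have d := is_derive_shrink
  (smooth_on_derivable (i := j) (x := shrink q i 0 q) fs I).
by rewrite Gq //; have [_ ->] := d; rewrite shrinkq eq_sym (negPf ji) mul1r.
Qed.

Lemma hadamard q f : smooth_on setT f ->
  exists G : 'I_m -> 'rV[R]_m -> R,
    [/\ forall i, smooth_on setT (G i),
        forall x, f x = f q + \sum_i (x 0 i - q 0 i) * G i x
      & forall i, G i q = 'D_(delta_mx 0 i) f q].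
Proof.
move=> fs; have [G [Gs GE Gq]] := hadamard_freeze q (enum_uniq 'I_m) fs.
exists G; split => //; last by move=> i; rewrite Gq // mem_enum.
move=> x; have := GE x; rewrite big_enum /= => <-.
suff -> : freeze q (enum 'I_m) x = q by rewrite addrC subrK.
by apply/rowP => j; rewrite mxE mem_enum.
Qed.

End Hadamard.

(** * The chain rule *)

Section ChainRule.
Context {R : realType}.

Lemma continuous_rV (X : topologicalType) n (T : X -> 'rV[R]_n) x :
  (forall j, {for x, continuous (fun y => T y 0 j)}) -> {for x, continuous T}.
Proof.
move=> cT A [P Pn PA].
have : \forall y \near x, forall j, P 0 j (T y 0 j).
  by apply: filter_forall => j; exact: cT (Pn 0 j).
by apply: filterS => y Py; apply: PA => i j; rewrite ord1.
Qed.

(** A product is differentiable at a zero of its first factor as soon as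
    this factor is differentiable and the second one is continuous. *)
Lemma is_derive_mul_vanish (V : normedModType R) (u w : V -> R) (x v : V) d :
  is_derive x v u d -> u x = 0 -> {for x, continuous w} ->
  is_derive x v (fun y => u y * w y) (d * w x).
Proof.
move=> du ux0 cw.
have cu : h^-1 *: ((u \o shift x) (h *: v) - u x) @[h --> (0 : R)^'] --> d.
  by have [u' <-] := du; exact: u'.
have lc : (fun s : R => s *: v + x) @ (0 : R)^' --> x.
  have lv : (fun s : R => s *: v) @ (0 : R) --> 0 *: v by exact: scalel_continuous.
  have := @cvgD _ _ _ _ _ _ (fun=> x) _ x lv (cvg_cst x); rewrite scale0r add0r.
  by move=> H A /H; exact: nbhs_dnbhs.
have cw' : w (h *: v + x) @[h --> (0 : R)^'] --> w x by apply: cvg_comp lc cw.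
have H : h^-1 *: (((fun y => u y * w y) \o shift x) (h *: v) - u x * w x)
    @[h --> (0 : R)^'] --> d * w x.
  have -> : (fun h : R => h^-1 *:
        (((fun y => u y * w y) \o shift x) (h *: v) - u x * w x)) =
      (fun h : R => h^-1 *: ((u \o shift x) (h *: v) - u x)) *
        (fun h => w (h *: v + x)).
    apply/funext => h.
    by rewrite /= !fctE /= ux0 mul0r !subr0 /GRing.scale /= mulrA.
  exact: cvgM cu cw'.
by apply: DeriveDef; [exact: (cvgP _ H) | exact: (cvg_lim _ H)].
Qed.

Context {m n : nat}.
Implicit Types (U : set 'rV[R]_m) (T : 'rV[R]_m -> 'rV[R]_n) (g : 'rV[R]_n -> R).

(** Hadamard's lemma at T x writes g o T as a constant plus products whose
    first factors T_j - T_j(x) vanish at x, so no total derivative of g is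
    needed. *)
Lemma is_derive_chain T g x i (dT : 'I_n -> R) : smooth_on setT g ->
  (forall j, {for x, continuous (fun y => T y 0 j)}) ->
  (forall j, is_derive x (delta_mx 0 i) (fun y => T y 0 j) (dT j)) ->
  is_derive x (delta_mx 0 i) (g \o T) (\sum_j dT j * 'D_(delta_mx 0 j) g (T x)).
Proof.
move=> gs cT dTx; have [G [Gs GE Gq]] := hadamard (T x) gs.
have -> : g \o T =
    cst (g (T x)) + \sum_j (fun y => (T y 0 j - T x 0 j) * G j (T y)).
  by apply/funext => y; rewrite /= GE; congr (_ + _); rewrite fct_sumE.
rewrite -[X in is_derive _ _ _ X]add0r; apply: is_deriveD.
apply: is_derive_sum => j; rewrite -Gq.
apply: (@is_derive_mul_vanish _ (fun y => T y 0 j - T x 0 j) (fun y => G j (T y))).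
- rewrite -[dT j]subr0; apply: (@is_deriveB _ _ _ (fun y => T y 0 j) (cst (T x 0 j))).
- by rewrite subrr.
- apply: (@continuous_comp _ _ _ T (G j)); first exact: continuous_rV.
  exact: smooth_on_continuous (Gs j) _.
Qed.

Lemma Ck_comp k U T g : open U -> smooth_on setT g ->
  (forall j, Ck k U (fun y => T y 0 j)) -> Ck k U (g \o T).
Proof.
move=> Uo; elim: k g => [|k IH] g gs TU.
all: have cT x : U x -> forall j, {for x, continuous (fun y => T y 0 j)}.
1,3: by move=> Ux j; exact: Ck_continuous (TU j) Ux.
all: have cg x : U x -> {for x, continuous (g \o T)}.
1,3: move=> Ux; apply: continuous_comp; first by apply: continuous_rV; exact: cT.
1,2: exact: smooth_on_continuous gs _.
  by split.
split=> // i.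
have d x : U x -> is_derive x (delta_mx 0 i) (g \o T)
    (\sum_j 'D_(delta_mx 0 i) (fun y => T y 0 j) x * 'D_(delta_mx 0 j) g (T x)).
  move=> Ux; apply: is_derive_chain => //; first exact: cT.
  by move=> j; apply: derivableP; have [_ /(_ i) [df _]] := TU j; exact: df.
split=> [x Ux|]; first by have [] := d x Ux.
have CkS' : Ck k U (fun x =>
    \sum_j 'D_(delta_mx 0 i) (fun y => T y 0 j) x * 'D_(delta_mx 0 j) g (T x)).
  elim: (index_enum _) => [|j r IHr].
    by apply: eq_Ck (Ck_cst k U 0) => // x _; rewrite big_nil.
  have Tj : Ck k U (fun x => 'D_(delta_mx 0 i) (fun y => T y 0 j) x).
    by have [_ /(_ i) [_]] := TU j.
  have gj := IH _ (smooth_on_derive j gs) (fun j => CkW (TU j)).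
  by apply: eq_Ck (CkD Uo (CkM Uo Tj gj) IHr) => // x _; rewrite big_cons.
by apply: eq_Ck CkS' => // x Ux; have [_ ->] := d x Ux.
Qed.

Lemma smooth_on_comp U T g : open U -> smooth_on setT g ->
  (forall j, smooth_on U (fun y => T y 0 j)) -> smooth_on U (g \o T).
Proof. by move=> Uo gs Ts k; apply: Ck_comp => // j; exact: Ts. Qed.

End ChainRule.

(** * Bump functions and extension by zero *)

Section Bump.
Context {R : realType} {m : nat}.
Implicit Types (c x : 'rV[R]_m) (r : R).

(** The closed cube with centre c and half-side r. *)
Definition cube c r : set 'rV[R]_m :=
  [set x | forall i, `[c 0 i - r, c 0 i + r]%classic (x 0 i)].

Lemma compact_cube c r : compact (cube c r).
Proof.
apply: (@rV_compact _ _ (fun i => `[c 0 i - r, c 0 i + r]%classic)) => i.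
exact: segment_compact.
Qed.

Lemma cube_sub (U : set 'rV[R]_m) c : open U -> U c ->
  exists2 r, 0 < r & cube c r `<=` U.
Proof.
move=> Uo Uc; have /nbhs_ballP[e /= e0 eU] := open_nbhs_nbhs (conj Uo Uc).
exists (e / 2); first by rewrite divr_gt0.
move=> x xc; apply: eU; split => // i j; rewrite ord1 /ball /=.
have := xc j; rewrite /= in_itv /= => /andP[l u].
rewrite ltr_norml; apply/andP; split; lra.
Qed.

(** A smooth function, positive on the Euclidean ball with centre c and
    radius r and zero elsewhere. *)
Definition bump c r x : R := flat 0 (r ^+ 2 - \sum_i (x 0 i - c 0 i) ^+ 2).

Lemma bump_center c r : 0 < r -> 0 < bump c r c.
Proof.
move=> r0; apply: flat_gt0; rewrite big1 ?subr0 ?exprn_gt0 // => i _.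
by rewrite subrr expr0n.
Qed.

Lemma bump_out c r x : 0 < r -> ~ cube c r x -> bump c r x = 0.
Proof.
move=> r0 /existsNP[i xi]; apply: flat_le0; rewrite subr_le0.
apply: (@le_trans _ _ ((x 0 i - c 0 i) ^+ 2)).
  have [//|] := leP (r ^+ 2) ((x 0 i - c 0 i) ^+ 2).
  rewrite -[ltLHS]real_normK ?num_real // ltr_pXn2r ?nnegrE ?normr_ge0 ?ltW //.
  rewrite ltr_norml => /andP[l u]; exfalso; apply: xi; rewrite /= in_itv /=.
  apply/andP; split; lra.
rewrite (bigD1 i) //= lerDl; apply: sumr_ge0 => j _; exact: sqr_ge0.
Qed.

Lemma smooth_bump c r : smooth_on setT (bump c r).
Proof.
have T := @openT 'rV[R]_m.
pose Q : 'rV[R]_m -> 'rV[R]_1 :=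
  fun x => \row__ (r ^+ 2 + \sum_i (-1) * ((x 0 i - c 0 i) * (x 0 i - c 0 i))).
have -> : bump c r = (fun y : 'rV[R]_1 => flat 0 (y 0 0)) \o Q.
  apply/funext => x; rewrite /bump /= mxE -sumrN; congr (flat _ (_ + _)).
  by apply: eq_bigr => i _; rewrite mulN1r expr2.
apply: smooth_on_comp => //; first exact: smooth_flat.
move=> j; rewrite [X in smooth_on _ X](_ : _ = fun x : 'rV[R]_m =>
  r ^+ 2 + \sum_i (-1) * ((x 0 i - c 0 i) * (x 0 i - c 0 i))); last first.
  by apply/funext => x; rewrite mxE.
have cst_s (a : R) : smooth_on setT (fun _ : 'rV[R]_m => a) by move=> k; exact: Ck_cst.
apply: smooth_onD => //; apply: smooth_on_sum => // i; apply: smooth_onM => //.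
by apply: smooth_onM => //; apply: smooth_onD => //; exact: smooth_coord.
Qed.

(** A function that is smooth on U and vanishes off a closed subset of U is
    smooth everywhere. *)
Lemma smooth_on_zero_extend (U K : set 'rV[R]_m) (g : 'rV[R]_m -> R) :
  open U -> closed K -> K `<=` U -> smooth_on U g ->
  (forall x, ~ K x -> g x = 0) -> smooth_on setT g.
Proof.
move=> Uo Kc KU gU g0 k.
have gK : Ck k (~` K) g.
  by apply: eq_Ck (Ck_cst k _ 0) => [|x /g0 //]; exact: closed_openC.
apply: CkS (CkU (gU k) gK) => x _.
by have [/KU|] := pselect (K x); [left|right].
Qed.

End Bump.

Section ExtensionByZero.
Context {R : realType} {m : nat} (M : smooth_manifold R m).
Implicit Types (c : chart R m M) (g : 'rV[R]_m -> R).

(** The function g read in the chart c, extended by 0 off its domain. *)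
Definition extend0 c g : M -> R :=
  fun p => if `[< chart_dom c p >] then g (chart_map c p) else 0.

Lemma extend0E c g p : chart_dom c p -> extend0 c g p = g (chart_map c p).
Proof. by move=> cp; rewrite /extend0 asboolT. Qed.

Lemma extend0_out c g p : ~ chart_dom c p -> extend0 c g p = 0.
Proof. by move=> cp; rewrite /extend0 asboolF. Qed.

Lemma open_chart_preimage c (A : set M) : open A ->
  open (chart_map c @` chart_dom c `&` chart_inv c @^-1` A).
Proof.
move=> Ao; rewrite openE => y [cy Ay]; apply: filterI.
  exact: open_nbhs_nbhs (conj (chart_img_open c) cy).
apply: (@chart_inv_continuous _ _ _ c y cy).
exact: open_nbhs_nbhs (conj Ao Ay).
Qed.

(** The support of g transported to M is compact, hence closed because M is
    Hausdorff; a second chart is covered by its overlap with c and by the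
    complement of this support. *)
Lemma smooth_extend0 c (K : set 'rV[R]_m) g : atlas c -> compact K ->
  K `<=` chart_map c @` chart_dom c -> smooth_on setT g ->
  (forall x, ~ K x -> g x = 0) -> smooth (extend0 c g).
Proof.
move=> Ac Kc Kimg gs g0 c' Ac' k.
pose S := chart_inv c @` K.
have Sclosed : closed S.
  apply: compact_closed; first exact: manifold_hausdorff.
  apply: continuous_compact => //; apply: continuous_in_subspaceT => y /set_mem Ky.
  exact: chart_inv_continuous (Kimg _ Ky).
pose U1 := chart_map c' @` (chart_dom c' `&` chart_dom c).
have U1E : U1 = chart_map c' @` chart_dom c' `&` chart_inv c' @^-1` chart_dom c.
  apply/seteqP; split=> [y [x [c'x cx] <-]|y [[x c'x <-]]] /=.
    by split; [exists x | rewrite chart_mapK].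
  by rewrite chart_mapK // => cx; exists x.
have U1o : open U1.
  by rewrite U1E; apply: open_chart_preimage; exact: chart_dom_open.
pose U2 := chart_map c' @` chart_dom c' `&` chart_inv c' @^-1` (~` S).
have U2o : open U2 by apply: open_chart_preimage; exact: closed_openC.
have C1 : Ck k U1 (extend0 c g \o chart_inv c').
  have sg : smooth_on U1 (g \o (fun y => chart_map c (chart_inv c' y))).
    by apply: smooth_on_comp => // j; exact: atlas_compatible.
  by apply: eq_Ck (sg k) => // y; rewrite U1E => -[_ cy] /=; rewrite extend0E.
have C2 : Ck k U2 (extend0 c g \o chart_inv c').
  apply: eq_Ck (Ck_cst k _ 0) => // y [_ /= nS].
  have [cy|cy] := pselect (chart_dom c (chart_inv c' y)); last by rewrite extend0_out.
  rewrite extend0E // g0 // => Ky; apply: nS.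
  by exists (chart_map c (chart_inv c' y)) => //; rewrite chart_mapK.
apply: CkS (CkU C1 C2) => y cy.
have [Sy|Sy] := pselect (S (chart_inv c' y)); last by right.
left; rewrite U1E; split => //=; case: Sy => z /Kimg [x cx <-] <-.
by rewrite chart_mapK.
Qed.

End ExtensionByZero.

(** * Decomposition of vector fields in a chart *)

Section Evaluation.
Context {R : realType} {m : nat} (M : smooth_manifold R m).
Implicit Types (f g : 'Coo(M)) (p : M) (X : vector_field M) (al : one_form M).

Lemma smoothE f : smooth (f : M -> R).
Proof. by case: f => f /= /asboolP. Qed.

Lemma Coo_eq f g : (forall p, f p = g p) -> f = g.
Proof. by move=> fg; apply: val_inj; apply/funext. Qed.

Lemma CooD f g p : (f + g) p = f p + g p. Proof. by []. Qed.
Lemma CooN f p : (- f) p = - f p. Proof. by []. Qed.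
Lemma CooM f g p : (f * g) p = f p * g p. Proof. by []. Qed.
Lemma Coo0 p : (0 : 'Coo(M)) p = 0. Proof. by []. Qed.
Lemma Coo1 p : (1 : 'Coo(M)) p = 1. Proof. by []. Qed.
Lemma CooC (a : R) p : cstC M a p = a. Proof. by []. Qed.
Definition CooE := (CooD, CooN, CooM, Coo0, Coo1, CooC).

Lemma Coo_sum (I : Type) (r : seq I) (F : I -> 'Coo(M)) p :
  (\sum_(i <- r) F i) p = \sum_(i <- r) F i p.
Proof. by elim/big_rec2: _ => // i y g _; rewrite CooD => ->. Qed.

Lemma vf0 X : X 0 = 0.
Proof. by apply: (addIr (X 0)); rewrite -vfD !add0r. Qed.

Lemma vf_sum X (I : Type) (r : seq I) (F : I -> 'Coo(M)) :
  X (\sum_(i <- r) F i) = \sum_(i <- r) X (F i).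
Proof. by elim/big_rec2: _ => [|i y g _ <-]; rewrite ?vf0 ?vfD. Qed.

Lemma vf1 X : X 1 = 0.
Proof.
by have := vfM X 1 1; rewrite !mulr1 mul1r -{1}[X 1]addr0 => /addrI/esym.
Qed.

Lemma sumvfE (I : Type) (r : seq I) (F : I -> vector_field M) f :
  (\sum_(i <- r) F i) f = \sum_(i <- r) F i f.
Proof. by elim/big_rec2: _ => // i y X _; rewrite addvfE => ->. Qed.

Lemma form_sum al (I : Type) (r : seq I) (F : I -> vector_field M) :
  al (\sum_(i <- r) F i) = \sum_(i <- r) al (F i).
Proof. by elim/big_rec2: _ => [|i y X _ <-]; rewrite ?Defs.form0 ?Defs.formD. Qed.

End Evaluation.

(** In this section chi is a smooth function on R^m that vanishes off a
    compact subset K of the image of the chart c. *)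
Section LocalCoordinates.
Context {R : realType} {m : nat} (M : smooth_manifold R m).
Context (c : chart R m M) (K : set 'rV[R]_m) (chi : 'rV[R]_m -> R).
Context (Ac : atlas c) (Kc : compact K)
  (Kimg : K `<=` chart_map c @` chart_dom c)
  (chis : smooth_on setT chi) (chi0 : forall x, ~ K x -> chi x = 0).
Implicit Types (f : 'Coo(M)) (q : M) (Z : vector_field M).
Local Notation img := (chart_map c @` chart_dom c).

Lemma cutoff_smooth g : smooth_on img g -> smooth_on setT (fun x => chi x * g x).
Proof.
move=> gs; apply: (@smooth_on_zero_extend _ _ img K) => //.
- exact: chart_img_open.
- exact: compact_closed Kc.
- apply: smooth_onM => //; first exact: chart_img_open.
  by move=> k; apply: CkS (chis k).
- by move=> x /chi0 ->; rewrite mul0r.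
Qed.

Lemma chart_fun_subproof g : smooth_on img g ->
  extend0 c (fun x => chi x * g x) \in smooth_pred (M := M).
Proof.
move=> gs; apply/asboolP; apply: (smooth_extend0 Ac Kc) => //; first exact: cutoff_smooth.
by move=> x /chi0 ->; rewrite mul0r.
Qed.

(** The global smooth function equal to chi g in the chart c and to 0 off
    its domain. *)
Definition chart_fun g (gs : smooth_on img g) : 'Coo(M) :=
  SmoothFun (chart_fun_subproof gs).

Lemma chart_funE g (gs : smooth_on img g) q : chart_dom c q ->
  chart_fun gs q = chi (chart_map c q) * g (chart_map c q).
Proof. by move=> cq; rewrite /chart_fun /= extend0E. Qed.

Lemma chart_fun_out g (gs : smooth_on img g) q :
  ~ chart_dom c q -> chart_fun gs q = 0.
Proof. by move=> cq; rewrite /chart_fun /= extend0_out. Qed.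

Lemma smooth_img g : smooth_on setT g -> smooth_on img g.
Proof. by move=> gs k; exact: CkS (gs k). Qed.

Lemma smooth1 : smooth_on img (fun=> 1 : R).
Proof. by move=> k; exact: Ck_cst. Qed.

(** The function chi read in the chart. *)
Definition cutoff : 'Coo(M) := chart_fun smooth1.

(** The i-th coordinate multiplied by chi. *)
Definition cut_coord (i : 'I_m) : 'Coo(M) :=
  chart_fun (smooth_img (smooth_coord i)).

Lemma smooth_local f : smooth_on img (f \o chart_inv c).
Proof. exact: smoothE. Qed.

Lemma partial_subproof i :
  ((fun f => chart_fun (smooth_on_derive i (smooth_local f)))
     : 'Coo(M) -> 'Coo(M)^o)
    \in derivation_pred (M := M).
Proof.
have img_c q : chart_dom c q -> img (chart_map c q) by move=> cq; exists q.
have d f q : chart_dom c q ->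
    derivable (f \o chart_inv c) (chart_map c q) (delta_mx 0 i).
  by move=> cq; apply: smooth_on_derivable (smooth_local f) (img_c q cq).
apply/asboolP; split=> [f g|a f|f g]; apply: Coo_eq => q.
- rewrite CooD; have [cq|cq] := pselect (chart_dom c q); last first.
    by rewrite !chart_fun_out // addr0.
  by rewrite !chart_funE // -mulrDr -deriveD //; exact: d.
- rewrite CooM CooC; have [cq|cq] := pselect (chart_dom c q); last first.
    by rewrite !chart_fun_out // mulr0.
  rewrite !chart_funE // mulrCA; congr (_ * _).
  by rewrite -[RHS]/(a *: _) -deriveZ //; exact: d.
- rewrite CooD !CooM; have [cq|cq] := pselect (chart_dom c q); last first.
    by rewrite !chart_fun_out // mul0r mulr0 addr0.
  rewrite !chart_funE //.
  have -> : 'D_(delta_mx 0 i) ((f * g) \o chart_inv c) (chart_map c q) =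
    f q * 'D_(delta_mx 0 i) (g \o chart_inv c) (chart_map c q) +
    g q * 'D_(delta_mx 0 i) (f \o chart_inv c) (chart_map c q).
    rewrite [LHS](deriveM (d f q cq) (d g q cq)) /= chart_mapK //.
  ring.
Qed.

(** The i-th coordinate vector field multiplied by chi. *)
Definition cut_partial i : vector_field M := VectorField (partial_subproof i).

Lemma cut_partialE i f q : chart_dom c q ->
  cut_partial i f q = chi (chart_map c q) *
    'D_(delta_mx 0 i) (f \o chart_inv c) (chart_map c q).
Proof. by move=> cq; rewrite [LHS]chart_funE. Qed.

Lemma cut_partial_out i f q : ~ chart_dom c q -> cut_partial i f q = 0.
Proof. by move=> cq; rewrite [LHS]chart_fun_out. Qed.

(** Hadamard's lemma for chi f at y, multiplied by chi^2 so that all its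
    terms extend to M, and differentiated along Z. *)
Lemma derivation_expand Z f q : chart_dom c q ->
  let y := chart_map c q in
  chi y ^+ 2 * (Z cutoff q * f q + chi y * Z f q) =
  \sum_i (Z (cut_coord i) q - y 0 i * Z cutoff q) *
    (chi y * 'D_(delta_mx 0 i) (fun x => chi x * (f \o chart_inv c) x) y).
Proof.
move=> cq y.
have [G [Gs GE Gq]] := hadamard y (cutoff_smooth (smooth_local f)).
have E : cutoff * cutoff * (cutoff * f) =
    cstC M (chi y * f q) * (cutoff * cutoff) +
    \sum_i (cut_coord i - cstC M (y 0 i) * cutoff) * chart_fun (smooth_img (Gs i)).
  apply: Coo_eq => q'; rewrite !CooE Coo_sum.
  have [cq'|cq'] := pselect (chart_dom c q'); last first.
    rewrite [cutoff q']chart_fun_out // !mul0r mulr0 add0r big1 // => i _.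
    by rewrite !CooE !chart_fun_out // mulr0.
  set y' := chart_map c q'.
  rewrite [cutoff q']chart_funE // mulr1.
  have -> : chi y' * f q' = chi y * f q + \sum_i (y' 0 i - y 0 i) * G i y'.
    by have := GE y'; rewrite /= !chart_mapK.
  rewrite mulrDr mulrC; congr (_ + _); rewrite mulr_sumr; apply: eq_bigr => i _.
  by rewrite !CooE !chart_funE // -/y' mulr1; ring.
have /(congr1 (fun h : 'Coo(M) => h q)) := congr1 Z E.
rewrite vfD vf_sum vfZ !vfM !CooE Coo_sum.
rewrite (eq_bigr (fun i => (Z (cut_coord i) q - y 0 i * Z cutoff q) *
   (chi y * 'D_(delta_mx 0 i) (fun x => chi x * (f \o chart_inv c) x) y))); last first.
  move=> i _; rewrite vfM vfB vfZ !CooE !chart_funE // -/y Gq mulr1; ring.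
rewrite [cutoff q]chart_funE // -/y mulr1 => H.
apply: (addrI (chi y * f q * (Z cutoff q * chi y + chi y * Z cutoff q))).
rewrite -H; ring.
Qed.

(** Comparing the previous expansion for f and for the constant function 1
    eliminates the terms that contain derivatives of chi. *)
Lemma cutoff_decomposition Z :
  cutoff ^+ 3 *: Z =
  \sum_i (cutoff * Z (cut_coord i) - cut_coord i * Z cutoff) *: cut_partial i.
Proof.
apply: vf_eq => f; apply: Coo_eq => q; rewrite scalevfE sumvfE Coo_sum.
have [cq|cq] := pselect (chart_dom c q); last first.
  rewrite !exprS !CooE [cutoff q]chart_fun_out // !mul0r big1 // => i _.
  by rewrite scalevfE CooM cut_partial_out // mulr0.
set y := chart_map c q.
have imgy : img y by exists q.
have df : forall i, derivable (f \o chart_inv c) y (delta_mx 0 i).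
  by move=> i; exact: smooth_on_derivable (smooth_local f) imgy.
have dchi : forall i, derivable chi y (delta_mx 0 i).
  by move=> i; exact: smooth_on_derivable chis I.
have Hf := derivation_expand Z f cq; have H1 := derivation_expand Z 1 cq.
rewrite /= -/y in Hf H1.
pose e i := Z (cut_coord i) q - y 0 i * Z cutoff q.
have {}H1 : chi y ^+ 2 * Z cutoff q =
    chi y * \sum_i e i * 'D_(delta_mx 0 i) chi y.
  move: H1; rewrite vf1 !CooE mulr0 addr0 mulr1 => ->; rewrite mulr_sumr.
  apply: eq_bigr => i _; rewrite -/(e i) mulrCA; congr (_ * (_ * _)).
  by congr ('D__ _ _); apply/funext => x; rewrite mulr1.
have {}Hf : chi y ^+ 2 * (Z cutoff q * f q + chi y * Z f q) =
    chi y * (\sum_i e i * cut_partial i f q) +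
    f q * (chi y * \sum_i e i * 'D_(delta_mx 0 i) chi y).
  rewrite Hf 2!mulr_sumr mulr_sumr -big_split; apply: eq_bigr => i _.
  rewrite cut_partialE // -/y -/(e i) [in LHS](deriveM (dchi i) (df i)).
  by rewrite /= chart_mapK // /GRing.scale /=; ring.
rewrite !exprS expr0 !CooE [cutoff q]chart_funE // -/y !mulr1.
have -> : chi y * (chi y * chi y) * Z f q = chi y * \sum_i e i * cut_partial i f q.
  apply: (addIr (f q * (chi y ^+ 2 * Z cutoff q))).
  rewrite [in RHS]H1 -Hf; ring.
rewrite mulr_sumr; apply: eq_bigr => i _.
rewrite scalevfE !CooE [cutoff q]chart_funE // [cut_coord i q]chart_funE //.
by rewrite -/y mulr1 /e; ring.
Qed.

End LocalCoordinates.

(** * Tensors act pointwise *)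

Section Tensoriality.
Context {R : realType} {m : nat} {M : smooth_manifold R m}.

(** A 1-form is only assumed to be linear over smooth functions; its value
    at p vanishes on vector fields that vanish at p. *)
Lemma form_pointwise0 (al : one_form M) (Z : vector_field M) (p : M) :
  (forall f, Z f p = 0) -> al Z p = 0.
Proof.
move=> Z0; have [c Ac cp] := atlas_cover p.
have [r r0 Kimg] := cube_sub (chart_img_open c) (imageP (chart_map c) cp).
(* The bump is centred at the image of p, where b does not vanish. *)
have := @cutoff_decomposition _ _ _ c _ _ Ac (@compact_cube _ _ _ _) Kimg
  (@smooth_bump _ _ _ r) (fun x => @bump_out _ _ _ _ x r0) Z.
set b := cutoff _ _ _ _ _ => dec.
have bp : b p != 0 by rewrite /b chart_funE // mulr1 gt_eqF // bump_center.
have /(congr1 (fun g : 'Coo(M) => g p)) := congr1 al dec.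
rewrite Defs.formZ form_sum !exprS expr0 !CooE Coo_sum big1 => [/eqP|i _].
  by rewrite mulr1 !mulf_eq0 (negPf bp) /= => /eqP.
by rewrite Defs.formZ !CooE !Z0 !mulr0 subrr mul0r.
Qed.

Lemma form_pointwise (al : one_form M) (X Y : vector_field M) (p : M) :
  (forall f, X f p = Y f p) -> al X p = al Y p.
Proof.
move=> XY; apply/eqP; rewrite -subr_eq0; apply/eqP.
have Zf : (forall f, (X + (-1) *: Y) f p = 0).
  by move=> f; rewrite addvfE scalevfE !CooE XY mulN1r subrr.
by have := form_pointwise0 al Zf; rewrite Defs.formD Defs.formZ !CooE mulN1r.
Qed.

(** The form X |-> (phi X) f reduces this to the case of forms. *)
Lemma endo_pointwise (phi : {linear vector_field M -> vector_field M})
    (X Y : vector_field M) (p : M) f :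
  (forall f, X f p = Y f p) -> phi X f p = phi Y f p.
Proof. exact: (form_pointwise (transpose phi (differential f))). Qed.

End Tensoriality.

(** * The Courant bracket of isotropic sections *)

Section LieAlgebra.
Context {R : realType} {m : nat} {M : smooth_manifold R m}.
Implicit Types (X Y Z : vector_field M) (al be : one_form M) (h f : 'Coo(M)).

Lemma oppvfE X f : (- X) f = - X f. Proof. by []. Qed.
Lemma zerovfE f : (0 : vector_field M) f = 0. Proof. by []. Qed.
Lemma lie_formE X be Z : lie_form X be Z = X (be Z) - be (lie_bracket X Z).
Proof. by []. Qed.

Lemma vfN X f : X (- f) = - X f.
Proof. by apply: (addIr (X f)); rewrite -vfD !addNr vf0. Qed.
Lemma formN al X : al (- X) = - al X.
Proof. by apply: (addIr (al X)); rewrite -Defs.formD !addNr Defs.form0. Qed.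
Lemma formB al X Y : al (X - Y) = al X - al Y.
Proof. by rewrite Defs.formD formN. Qed.

Lemma lie_bracketC X Y : lie_bracket X Y = - lie_bracket Y X.
Proof. by apply: vf_eq => f; rewrite oppvfE !lie_bracketE opprB. Qed.
Lemma lie_bracketZl X h Y :
  lie_bracket (h *: Y) X = h *: lie_bracket Y X - X h *: Y.
Proof.
by rewrite lie_bracketC lie_bracketZr lie_bracketC scalerN opprD opprK.
Qed.
Lemma lie_bracketDl X Y Z :
  lie_bracket (Y + Z) X = lie_bracket Y X + lie_bracket Z X.
Proof.
by rewrite lie_bracketC lie_bracketDr opprD -!(lie_bracketC _ X).
Qed.
Lemma lie_bracketNr X Y : lie_bracket X (- Y) = - lie_bracket X Y.
Proof.
by apply: (addIr (lie_bracket X Y)); rewrite -lie_bracketDr !addNr;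
  apply: vf_eq => f; rewrite lie_bracketE zerovfE vf0 subrr.
Qed.
Lemma lie_bracketNl X Y : lie_bracket (- Y) X = - lie_bracket Y X.
Proof. by rewrite lie_bracketC lie_bracketNr opprK lie_bracketC. Qed.

(** Real and imaginary parts of the Lie derivative of al + i be along the
    complex vector field X + i Y. *)
Definition clie_re X Y al be Z := lie_form X al Z - lie_form Y be Z.
Definition clie_im X Y al be Z := lie_form X be Z + lie_form Y al Z.

Implicit Types (s t : csection M).

(** The complex 1-form part of t vanishes on the complex vector part of s. *)
Definition isotropic s t :=
  [/\ t.1.2 s.1.1 = t.2.2 s.2.1 & t.2.2 s.1.1 = - t.1.2 s.2.1].

Lemma ccourant_re s t Z : isotropic s t -> isotropic t s ->
  (ccourant s t).1.2 Z =
  clie_re s.1.1 s.2.1 t.1.2 t.2.2 Z - clie_re t.1.1 t.2.1 s.1.2 s.2.2 Z.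
Proof.
case: s t => [[X al] [Y be]] [[X' al'] [Y' be']] [/= E1 _] [/= E2 _].
rewrite /clie_re; cbn [fst snd]; rewrite -[LHS]/(
  lie_form X al' Z - lie_form X' al Z - cstC M 2^-1 * Z (al' X - al X') -
  (lie_form Y be' Z - lie_form Y' be Z - cstC M 2^-1 * Z (be' Y - be Y'))).
rewrite E1 E2; ring.
Qed.

Lemma ccourant_im s t Z : isotropic s t -> isotropic t s ->
  (ccourant s t).2.2 Z =
  clie_im s.1.1 s.2.1 t.1.2 t.2.2 Z - clie_im t.1.1 t.2.1 s.1.2 s.2.2 Z.
Proof.
case: s t => [[X al] [Y be]] [[X' al'] [Y' be']] [/= _ E1] [/= _ E2].
rewrite /clie_im; cbn [fst snd]; rewrite -[LHS]/(
  lie_form X be' Z - lie_form Y' al Z - cstC M 2^-1 * Z (be' X - al Y') +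
  (lie_form Y al' Z - lie_form X' be Z - cstC M 2^-1 * Z (al' Y - be X'))).
rewrite E1 E2 !(vfB, vfN); ring.
Qed.

End LieAlgebra.

(** * Identities for normal almost contact structures *)

Section Normal.
Context {R : realType} {m : nat} {M : smooth_manifold R m}.
Context (phi : {linear vector_field M -> vector_field M})
  (F : vector_field M) (eta : one_form M).
Context (normal : normal_almost_contact phi F eta).
Implicit Types (X Y Z : vector_field M) (al be : one_form M) (h f : 'Coo(M)).
Local Notation lb := lie_bracket.

Let phiD X Y : phi (X + Y) = phi X + phi Y. Proof. exact: linearD. Qed.
Let phiN X : phi (- X) = - phi X. Proof. exact: linearN. Qed.
Let phiZ h X : phi (h *: X) = h *: phi X. Proof. exact: linearZ. Qed.
Let phi0 : phi 0 = 0. Proof. exact: linear0. Qed.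

Lemma phi_phi X : phi (phi X) = - X + eta X *: F.
Proof. by have [[pp _] _ _ _] := normal; exact: pp. Qed.

Lemma eta_F : eta F = 1.
Proof. by have [[_ e] _ _ _] := normal. Qed.

Lemma Coo_sqr_eq0 h : h * h = 0 -> h = 0.
Proof.
move=> hh; apply: Coo_eq => p.
have /eqP := congr1 (fun g : 'Coo(M) => g p) hh.
by rewrite !CooE mulf_eq0 orbb => /eqP.
Qed.

Lemma phi_F : phi F = 0.
Proof.
have pp : phi (phi F) = 0 by rewrite phi_phi eta_F scale1r addNr.
have [h pF] : exists h, phi F = h *: F.
  exists (eta (phi F)); have := phi_phi (phi F); rewrite pp phi0.
  by move=> /esym/eqP; rewrite addrC subr_eq0 => /eqP/esym.
suff h0 : h = 0 by rewrite pF h0 scale0r.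
apply: Coo_sqr_eq0; move: pp; rewrite pF phiZ pF scalerA => /(congr1 eta).
by rewrite Defs.formZ eta_F mulr1 Defs.form0.
Qed.

Lemma eta_phi X : eta (phi X) = 0.
Proof.
have : phi (phi (phi X)) = - phi X.
  by rewrite [phi (phi X)]phi_phi phiD phiN phiZ phi_F scaler0 addr0.
rewrite phi_phi -[RHS]addr0 => /addrI/(congr1 eta).
by rewrite Defs.formZ eta_F mulr1 Defs.form0.
Qed.

Lemma lieF_phi X : (lb F (phi X)) = phi (lb F X).
Proof.
by have [_ _ L _] := normal; have /eqP := L X; rewrite /lie_endo subr_eq0 => /eqP.
Qed.

Lemma eta_lie_phi_phi X Y :
  eta (lb (phi X) (phi Y)) = eta (lb X Y) - X (eta Y) + Y (eta X).
Proof.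
have [_ N _ _] := normal; have := congr1 eta (N X Y).
rewrite /nijenhuis !(Defs.formD, formN, eta_phi, Defs.formZ, eta_F) /d_form.
by rewrite addr0 subr0 mulr1 => ->; ring.
Qed.

(** The image under phi of the Nijenhuis condition; since phi F = 0 the
    right-hand side of that condition drops out. *)
Lemma phi_lie_phi_phi X Y :
  phi (lb (phi X) (phi Y)) = phi (lb X Y) - (lb X (phi Y)) - (lb (phi X) Y)
    + eta ((lb X (phi Y)) + (lb (phi X) Y)) *: F.
Proof.
have [_ N _ _] := normal; have := congr1 phi (N X Y).
rewrite /nijenhuis !(phiD, phiN, phiZ, phi_F, phi_phi, scaler0, oppr0, Defs.formD).
move=> H; apply: vf_eq => f.
have := congr1 (fun Z : vector_field M => Z f) H.
rewrite !(addvfE, oppvfE, scalevfE, zerovfE) eta_phi => {}H.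
rewrite -[LHS]subr0 -{}H; ring.
Qed.

(** Equivalently, d eta (X, phi Y) + d eta (phi X, Y) = 0. *)
Lemma eta_lie_phi X Y :
  eta (lb X (phi Y)) + eta (lb (phi X) Y) = phi X (eta Y) - phi Y (eta X).
Proof.
have := eta_lie_phi_phi X (phi Y).
rewrite phi_phi lie_bracketDr lie_bracketNr lie_bracketZr.
rewrite !(Defs.formD, formN, Defs.formZ, eta_F, eta_phi) vf0.
rewrite [lb (phi X) F]lie_bracketC lieF_phi formN eta_phi => H.
apply: (addIr (- eta (lb (phi X) Y))); rewrite addrK.
have {1}-> : eta (lb X (phi Y)) =
    eta (lb X (phi Y)) - 0 + phi Y (eta X) - phi Y (eta X) by ring.
rewrite -H; ring.
Qed.

End Normal.

(** * Closedness of the sections of L and L-star *)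

Section EigenbundleSections.
Context {R : realType} {m : nat} {M : smooth_manifold R m}.
Context (phi : {linear vector_field M -> vector_field M})
  (F : vector_field M) (eta : one_form M).
Context (normal : normal_almost_contact phi F eta).
Implicit Types (X Y Z : vector_field M) (al be : one_form M) (h f : 'Coo(M))
  (s t : csection M).
Local Notation lb := lie_bracket.

Let phiD X Y : phi (X + Y) = phi X + phi Y. Proof. exact: linearD. Qed.
Let phiN X : phi (- X) = - phi X. Proof. exact: linearN. Qed.
Let phiZ h X : phi (h *: X) = h *: phi X. Proof. exact: linearZ. Qed.
Let phi0 : phi 0 = 0. Proof. exact: linear0. Qed.
Let phiF := phi_F normal.
Let etaF := eta_F normal.
Let etaphi := eta_phi normal.
Let phiphi := phi_phi normal.
Let formE := (@Defs.formD R m M, @formN R m M, @Defs.formZ R m M, @Defs.form0 R m M,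
  etaphi, etaF).
Let lbE := (@lie_bracketDr R m M, @lie_bracketDl R m M, @lie_bracketNr R m M,
  @lie_bracketNl R m M, @lie_bracketZr R m M, @lie_bracketZl R m M).
Let phiE := (phiD, phiN, phiZ, phi0, phiF, phiphi, scaler0, oppr0).
Let vfE := (@addvfE R m M, @oppvfE R m M, @scalevfE R m M, @zerovfE R m M).
Let lbF X : lb X F = - lb F X. Proof. exact: lie_bracketC. Qed.
Let lbFF : lb F F = 0.
Proof. by apply: vf_eq => f; rewrite lie_bracketE subrr. Qed.

(** Global description of the sections (X + al) + i (Y + be) of L. *)
Definition sectionL s :=
  [/\ s.2.1 = eta s.2.1 *: F - phi s.1.1, s.1.2 F = 0
    & forall Z, s.2.2 Z = s.1.2 (phi Z)].

(** Global description of the sections (X + al) + i (Y + be) of L-star. *)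
Definition sectionLstar s :=
  [/\ eta s.1.1 = 0, s.2.1 = phi s.1.1
    & forall Z, s.2.2 Z = s.2.2 F * eta Z - s.1.2 (phi Z)].

Lemma lie_sectionL X Y X' Y' :
  Y = eta Y *: F - phi X -> Y' = eta Y' *: F - phi X' ->
  lb X Y' + lb Y X' =
  eta (lb X Y' + lb Y X') *: F - phi (lb X X' - lb Y Y').
Proof.
move: (eta Y) (eta Y') => h h' -> ->.
rewrite !lbE lbFF !lbF !(lieF_phi normal) !phiE (phi_lie_phi_phi normal) !formE.
apply: vf_eq => f; rewrite !vfE; ring.
Qed.

Lemma clie_sectionL_F X Y al be :
  Y = eta Y *: F - phi X -> al F = 0 -> (forall Z, be Z = al (phi Z)) ->
  clie_re X Y al be F = 0.
Proof.
move: (eta Y) => h -> alF be_al; rewrite /clie_re !lie_formE !be_al phiF alF !formE.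
rewrite !vf0 !lbE lbFF !lbF (lieF_phi normal) !phiE !formE alF; ring.
Qed.

Lemma clie_sectionL X Y al be Z :
  Y = eta Y *: F - phi X -> al F = 0 -> (forall Z, be Z = al (phi Z)) ->
  clie_im X Y al be Z = clie_re X Y al be (phi Z).
Proof.
move: (eta Y) => h -> alF be_al; rewrite /clie_re /clie_im !lie_formE !be_al.
rewrite !lbE (lieF_phi normal) !phiE (phi_lie_phi_phi normal) !formE alF.
rewrite !vfE !mulr0 !addr0 !vfN; ring.
Qed.

Lemma isotropicL s t : sectionL s -> sectionL t -> isotropic s t.
Proof.
move=> [Ys _ _] [_ alF be_al]; split; rewrite be_al Ys ?phiE !formE ?alF; ring.
Qed.

Lemma ccourant_sectionL s t :
  sectionL s -> sectionL t -> sectionL (ccourant s t).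
Proof.
move=> Ls Lt; have [Is It] := (isotropicL Ls Lt, isotropicL Lt Ls).
have [Ys aFs bs] := Ls; have [Yt aFt bt] := Lt; split.
- exact: lie_sectionL.
- by rewrite ccourant_re // !clie_sectionL_F // subrr.
- by move=> Z; rewrite ccourant_re // ccourant_im // !clie_sectionL.
Qed.

Lemma eta_lie_sectionLstar X X' : eta X = 0 -> eta X' = 0 ->
  eta (lb X X' - lb (phi X) (phi X')) = 0.
Proof.
move=> X0 X'0; rewrite !formE (eta_lie_phi_phi normal) X0 X'0 !vf0; ring.
Qed.

Lemma lie_sectionLstar X X' : eta X = 0 -> eta X' = 0 ->
  lb X (phi X') + lb (phi X) X' = phi (lb X X' - lb (phi X) (phi X')).
Proof.
move=> X0 X'0; rewrite !phiE (phi_lie_phi_phi normal) Defs.formD (eta_lie_phi normal).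
rewrite X0 X'0 !vf0.
apply: vf_eq => f; rewrite !vfE; ring.
Qed.

(** The multiple of eta on the right is the component of the result along
    L_eta. *)
Lemma clie_sectionLstar X al be Z : eta X = 0 ->
  (forall Z, be Z = be F * eta Z - al (phi Z)) ->
  clie_im X (phi X) al be Z =
  (X (be F) + phi X (al F)) * eta Z - clie_re X (phi X) al be (phi Z).
Proof.
move=> X0; move: (be F) => k be_al.
rewrite /clie_re /clie_im !lie_formE !be_al !phiE (phi_lie_phi_phi normal) !formE.
rewrite (eta_lie_phi_phi normal) (eta_lie_phi normal) X0 !vf0.
rewrite !vfB !vfD !vfM !vfN !vf0; ring.
Qed.

Lemma isotropicLstar s t : sectionLstar s -> sectionLstar t -> isotropic s t.
Proof.
move=> [X0 Ys _] [_ _ be_al]; split; rewrite be_al Ys ?phiE ?formE ?X0; ring.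
Qed.

Lemma ccourant_sectionLstar s t :
  sectionLstar s -> sectionLstar t -> sectionLstar (ccourant s t).
Proof.
move=> Ls Lt; have [Is It] := (isotropicLstar Ls Lt, isotropicLstar Lt Ls).
have [Xs Ys bs] := Ls; have [Xt Yt bt] := Lt; split.
- by rewrite /= Ys Yt eta_lie_sectionLstar.
- by rewrite /= Ys Yt lie_sectionLstar.
have Cs Z := clie_sectionLstar Z Xs bt; have Ct Z := clie_sectionLstar Z Xt bs.
move=> Z; rewrite (ccourant_re _ Is It) !(ccourant_im _ Is It) Ys Yt !Cs !Ct.
rewrite phiF etaF /clie_re !Defs.form0; ring.
Qed.

End EigenbundleSections.

(** * From fibres to global sections *)

Section PointwiseSections.
Context {R : realType} {m : nat} {M : smooth_manifold R m}.
Implicit Types (X Y Z : vector_field M) (al be : one_form M) (f : 'Coo(M))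
  (s t : csection M) (p : M) (u : gsection M).

Lemma cvalueP p s t : cvalue p s = cvalue p t <->
  [/\ forall f, s.1.1 f p = t.1.1 f p, forall X, s.1.2 X p = t.1.2 X p,
      forall f, s.2.1 f p = t.2.1 f p & forall X, s.2.2 X p = t.2.2 X p].
Proof.
split=> [[E1 E2 E3 E4]|[E1 E2 E3 E4]].
  split=> z.
  - exact: (congr1 (fun k => k z) E1).
  - exact: (congr1 (fun k => k z) E2).
  - exact: (congr1 (fun k => k z) E3).
  - exact: (congr1 (fun k => k z) E4).
by congr ((_, _), (_, _)); apply/funext.
Qed.

Lemma in_lineP u p s : in_line u p s <-> exists a b : R,
  [/\ forall f, s.1.1 f p = a * u.1 f p, forall X, s.1.2 X p = a * u.2 X p,
      forall f, s.2.1 f p = b * u.1 f p & forall X, s.2.2 X p = b * u.2 X p].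
Proof.
have L1 a b f : (cstC M a *: to_csection u + cstC M b *: mul_i (to_csection u)).1.1 f p
    = a * u.1 f p + b * - 0 by [].
have L2 a b X : (cstC M a *: to_csection u + cstC M b *: mul_i (to_csection u)).1.2 X p
    = a * u.2 X p + b * - 0 by [].
have L3 a b f : (cstC M a *: to_csection u + cstC M b *: mul_i (to_csection u)).2.1 f p
    = a * 0 + b * u.1 f p by [].
have L4 a b X : (cstC M a *: to_csection u + cstC M b *: mul_i (to_csection u)).2.2 X p
    = a * 0 + b * u.2 X p by [].
split=> -[a [b]].
  move=> /cvalueP[E1 E2 E3 E4]; exists a, b; split=> z.
  - by rewrite E1 L1 oppr0 mulr0 addr0.
  - by rewrite E2 L2 oppr0 mulr0 addr0.
  - by rewrite E3 L3 mulr0 add0r.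
  - by rewrite E4 L4 mulr0 add0r.
move=> [E1 E2 E3 E4]; exists a, b; apply/cvalueP; split=> z.
- by rewrite E1 L1 oppr0 mulr0 addr0.
- by rewrite E2 L2 oppr0 mulr0 addr0.
- by rewrite E3 L3 mulr0 add0r.
- by rewrite E4 L4 mulr0 add0r.
Qed.

Context (phi : {linear vector_field M -> vector_field M})
  (F : vector_field M) (eta : one_form M).
Context (normal : normal_almost_contact phi F eta).
Local Notation J := (associated_structure phi F eta).

Let phiF f p : phi F f p = 0.
Proof. by rewrite (phi_F normal). Qed.
Let phiZF (h : 'Coo(M)) : phi (h *: F) = 0.
Proof. by rewrite linearZ_LR (phi_F normal) scaler0. Qed.
Let eta_phi_p X p : eta (phi X) p = 0.
Proof. by rewrite (eta_phi normal). Qed.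
Let etaF p : eta F p = 1.
Proof. by rewrite (eta_F normal). Qed.

(** If X = W + a F at p, then eta(X) = eta(W) + a and phi X = phi W at p. *)
Lemma endo_combine (W X : vector_field M) (a : R) p :
  (forall f, X f p = W f p + a * F f p) ->
  eta X p = eta W p + a /\ forall f, phi X f p = phi W f p.
Proof.
move=> XE.
have XE' f : X f p = (W + cstC M a *: F) f p by rewrite XE.
split=> [|f].
  by rewrite (form_pointwise eta XE') Defs.formD Defs.formZ !CooE etaF mulr1.
by rewrite (endo_pointwise phi f XE') linearD phiZF addr0.
Qed.

Lemma in_L_sectionL s : (forall p, in_L J p s) -> sectionL phi F eta s.
Proof.
case: s => [[X al] [Y be]] inL.
have key p : [/\ forall f, Y f p = eta Y p * F f p - phi X f p, al F p = 0
    & forall Z, be Z p = al (phi Z) p].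
  have [[[X1 al1] [Y1 be1]] [s2 [/in_lineP[a [b [/= X1E al1E Y1E be1E]]]]]] := inL p.
  move=> [[W w] [/= etaW wF] /cvalueP[/= X2E al2E Y2E be2E]].
  move=> /cvalueP[/= XE alE YE beE].
  have {}XE f : X f p = X1 f p + s2.1.1 f p := XE f.
  have {}alE Z : al Z p = al1 Z p + s2.1.2 Z p := alE Z.
  have {}YE f : Y f p = Y1 f p + s2.2.1 f p := YE f.
  have {}beE Z : be Z p = be1 Z p + s2.2.2 Z p := beE Z.
  have {}X2E f : s2.1.1 f p = W f p - - 0 := X2E f.
  have {}al2E Z : s2.1.2 Z p = w Z p - - 0 := al2E Z.
  have {}Y2E f : s2.2.1 f p = 0 - phi W f p := Y2E f.
  have {}be2E Z : s2.2.2 Z p = 0 - - w (phi Z) p := be2E Z.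
  have {}al1E Z : al1 Z p = a * 0 := al1E Z.
  have {}be1E Z : be1 Z p = b * 0 := be1E Z.
  (* At p, X + i Y = (a + i b) F + (W - i phi W) and al + i be = w + i (w o phi). *)
  have X_p f : X f p = W f p + a * F f p by rewrite XE X1E X2E; ring.
  have Y_p f : Y f p = b * F f p - phi W f p by rewrite YE Y1E Y2E; ring.
  have al_p Z : al Z p = w Z p by rewrite alE al1E al2E; ring.
  have be_p Z : be Z p = w (phi Z) p by rewrite beE be1E be2E; ring.
  have [_ phiX] := endo_combine X_p.
  have Y_p' f : Y f p = (- phi W) f p + b * F f p.
    by rewrite Y_p addrC.
  have [etaY _] := endo_combine Y_p'.
  split=> [f||Z].
  - by rewrite Y_p phiX etaY formN CooE eta_phi_p oppr0 add0r.
  - by rewrite al_p.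
  - by rewrite be_p al_p.
split=> /=.
- by apply: vf_eq => f; apply: Coo_eq => p; have [/(_ f)] := key p.
- by apply: Coo_eq => p; have [_] := key p.
- by move=> Z; apply: Coo_eq => p; have [_ _ /(_ Z)] := key p.
Qed.

Lemma sectionL_in_L s : sectionL phi F eta s -> forall p, in_L J p s.
Proof.
case: s => [[X al] [Y be]] [/= YE alF be_al] p.
pose e : gsection M := (X - eta X *: F, al).
exists ((eta X *: F, 0), (eta Y *: F, 0)),
  (to_csection e - mul_i (to_csection (Phi_of phi e))).
split.
- apply/in_lineP; exists (eta X p), (eta Y p); split=> z //.
  + by rewrite -[RHS]/(eta X p * 0) mulr0.
  + by rewrite -[RHS]/(eta Y p * 0) mulr0.
- exists e => //; split => /=; last by rewrite alF.
  by rewrite formB Defs.formZ !CooE etaF mulr1 subrr.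
- apply/cvalueP; split=> z.
  + by rewrite -[RHS]/(eta X p * F z p + (X z p - eta X p * F z p - - 0)); ring.
  + by rewrite -[RHS]/(0 + (al z p - - 0)); ring.
  + rewrite -[RHS]/(eta Y p * F z p + (0 - phi (X - eta X *: F) z p)).
    rewrite linearB phiZF subr0 -[LHS]/(Y z p) {1}YE.
    by rewrite -[LHS]/(eta Y p * F z p - phi X z p); ring.
  + rewrite -[LHS]/(be z p) be_al -[RHS]/(0 + (0 - - al (phi z) p)); ring.
Qed.

Lemma in_Lstar_sectionLstar s :
  (forall p, in_Lstar J p s) -> sectionLstar phi F eta s.
Proof.
case: s => [[X al] [Y be]] inL.
have key p : [/\ eta X p = 0, forall f, Y f p = phi X f p
    & forall Z, be Z p = be F p * eta Z p - al (phi Z) p].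
  have [[[X1 al1] [Y1 be1]] [s2 [/in_lineP[a [b [/= X1E al1E Y1E be1E]]]]]] := inL p.
  move=> [[W w] [/= etaW wF] /cvalueP[/= X2E al2E Y2E be2E]].
  move=> /cvalueP[/= XE alE YE beE].
  have {}XE f : X f p = X1 f p + s2.1.1 f p := XE f.
  have {}alE Z : al Z p = al1 Z p + s2.1.2 Z p := alE Z.
  have {}YE f : Y f p = Y1 f p + s2.2.1 f p := YE f.
  have {}beE Z : be Z p = be1 Z p + s2.2.2 Z p := beE Z.
  have {}X2E f : s2.1.1 f p = W f p + - 0 := X2E f.
  have {}al2E Z : s2.1.2 Z p = w Z p + - 0 := al2E Z.
  have {}Y2E f : s2.2.1 f p = 0 + phi W f p := Y2E f.
  have {}be2E Z : s2.2.2 Z p = 0 + - w (phi Z) p := be2E Z.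
  have {}X1E f : X1 f p = a * 0 := X1E f.
  have {}Y1E f : Y1 f p = b * 0 := Y1E f.
  (* At p, X + i Y = W + i phi W and
     al + i be = (a + i b) eta + (w - i (w o phi)). *)
  have X_p f : X f p = W f p by rewrite XE X1E X2E; ring.
  have Y_p f : Y f p = phi W f p by rewrite YE Y1E Y2E; ring.
  have al_p Z : al Z p = a * eta Z p + w Z p by rewrite alE al1E al2E; ring.
  have be_p Z : be Z p = b * eta Z p - w (phi Z) p by rewrite beE be1E be2E; ring.
  split=> [|f|Z].
  - by rewrite (form_pointwise eta X_p).
  - by rewrite Y_p (endo_pointwise phi f X_p).
  - rewrite !be_p al_p etaF eta_phi_p (phi_F normal) Defs.form0 !CooE.
    by rewrite mulr1 subr0 mulr0 add0r.
split=> /=.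
- by apply: Coo_eq => p; have [] := key p.
- by apply: vf_eq => f; apply: Coo_eq => p; have [_ /(_ f)] := key p.
- by move=> Z; apply: Coo_eq => p; have [_ _ /(_ Z)] := key p.
Qed.

Lemma sectionLstar_in_Lstar s :
  sectionLstar phi F eta s -> forall p, in_Lstar J p s.
Proof.
case: s => [[X al] [Y be]] [/= etaX YE be_al] p.
pose e : gsection M := (X, al - al F *: eta).
exists ((0, al F *: eta), (0, be F *: eta)),
  (to_csection e + mul_i (to_csection (Phi_of phi e))).
split.
- apply/in_lineP; exists (al F p), (be F p); split=> z //.
  + by rewrite -[RHS]/(al F p * 0) mulr0.
  + by rewrite -[RHS]/(be F p * 0) mulr0.
- exists e => //; split => /=; first by rewrite etaX.
  by rewrite -[LHS]/(al F p - al F p * eta F p) etaF mulr1 subrr.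
- apply/cvalueP; split=> z.
  + by rewrite -[RHS]/(0 + (X z p + - 0)); ring.
  + by rewrite -[RHS]/(al F p * eta z p + (al z p - al F p * eta z p + - 0)); ring.
  + by rewrite -[LHS]/(Y z p) YE -[RHS]/(0 + (0 + phi X z p)); ring.
  + rewrite -[LHS]/(be z p) be_al -[LHS]/(be F p * eta z p - al (phi z) p).
    rewrite -[RHS]/(be F p * eta z p +
      (0 - (al (phi z) p - al F p * eta (phi z) p))) eta_phi_p; ring.
Qed.

End PointwiseSections.

Theorem proposition3p4 (R : realType) (n : nat)
    (M : smooth_manifold R n.*2.+1)
    (phi : {linear vector_field M -> vector_field M})
    (F : vector_field M) (eta : one_form M) :
  normal_almost_contact phi F eta ->
  strong_generalized_contact (associated_structure phi F eta).
Proof.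
move=> normal; split=> s t sL tL.
- by apply: sectionL_in_L => //; apply: ccourant_sectionL => //;
    exact: in_L_sectionL.
- by apply: sectionLstar_in_Lstar => //; apply: ccourant_sectionLstar => //;
    exact: in_Lstar_sectionLstar.
Qed.
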